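(* Let $e\in\mathbb{S}$, let $k$ be a commutative ring and let $R$ be a $k$-algebra on which multiplication by every positive integer dividing $e$ is injective. Then $R$ has a universal abelian $e$-torsion grading if and only if $X_e(R)$ is a subgroup of $A=\mathrm{Aut}_{k'\text{-alg}}(R')$ that is abelian and compact in the compact-open topology of $A$ (with $R'$ discrete).
   Context: Steinitz numbers $\mathbb{S}$: formal products $\prod_p p^{n_p}$, $n_p\in\mathbb{Z}_{\ge0}\cup\{\infty\}$; a positive integer $d$ divides $e$ if $\mathrm{ord}_p(d)\le n_p$ for all $p$. $\mu_e\subseteq\mathbb{C}^*$: roots of unity of order dividing $e$. $R'=R\otimes_{\mathbb{Z}}\mathbb{Z}[\mu_e]$, $k'=k\otimes_{\mathbb{Z}}\mathbb{Z}[\mu_e]$. $\hat{\mathbb{Z}}/e\hat{\mathbb{Z}}=\varprojlim_{d\mid e}\mathbb{Z}/d\mathbb{Z}$ acts on $\mu_e$ by exponentiation; $a\in(\hat{\mathbb{Z}}/e\hat{\mathbb{Z}})^*$ gives an automorphism $\tau_a$ of $R'$ acting on the second factor. $M(f,\lambda)=\{x:f(x)=\lambda x\}$; $f$ is $\mu_e$-diagonalizable if $\bigoplus_{\zeta\in\mu_e}M(f,\zeta)\to M$ is an isomorphism, and then $f^a$ acts on $M(f,\zeta)$ by $\zeta^a$. $X_e(R)=\{\sigma\in A:\sigma\ \mu_e\text{-diagonalizable},\ \tau_a\sigma\tau_a^{-1}=\sigma^a\ \forall a\in(\hat{\mathbb{Z}}/e\hat{\mathbb{Z}})^*\}$. Since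 $R'$ is discrete, the compact-open topology on $A$ has subbase $\{f\in A:f(x)=y\}$, $x,y\in R'$. An abelian group is $e$-torsion if every element has finite order dividing $e$. An abelian $e$-torsion grading of $R$ (as $k$-algebra) is $(R,\Gamma,\{R_\gamma\})$ with $\Gamma$ abelian $e$-torsion, $\{R_\gamma\}$ $k$-submodules with $\bigoplus R_\gamma\cong R$, $1\in R_1$, $R_\gamma R_\delta\subseteq R_{\gamma\delta}$. It is universal if for every such grading with group $\Gamma$ there is a unique homomorphism $\varphi$ from its group to $\Gamma$ with $\varphi_*$ of it equal to the given grading, where $\varphi_*\{R_\gamma\}=\{\sum_{\gamma\in\varphi^{-1}\delta}R_\gamma\}_\delta$. *)

(* Defs.v *)
From HB Require Import structures.
From mathcomp Require Import all_boot all_order all_algebra all_field.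
From Stdlib Require List.
Set Implicit Arguments. Unset Strict Implicit. Unset Printing Implicit Defensive.
Import Order.TTheory GRing.Theory Num.Theory.
Local Open Scope ring_scope.

(* Steinitz numbers: e p = Some n  means  n_p = n,  e p = None means n_p = oo.
   Only the values at primes p matter. *)
Definition steinitz := nat -> option nat.

Definition steinitz_dvd (d : nat) (e : steinitz) : Prop :=
  (0 < d)%N /\ forall p : nat, prime p ->
    match e p with None => true | Some n => (logn p d <= n)%N end.

Definition mu (e : steinitz) (z : algC) : Prop :=
  exists d : nat, steinitz_dvd d e /\ z ^+ d = 1.

Definition Zmu (e : steinitz) (z : algC) : Prop :=
  forall S : algC -> Prop,
    S 1 -> (forall x y, S x -> S y -> S (x - y)) ->
    (forall x y, S x -> S y -> S (x * y)) ->
    (forall w, mu e w -> S w) -> S z.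

(* units of  Zhat / e Zhat = lim_{d | e} Z/dZ : compatible families of
   residues a d (mod d), each a unit mod d *)
Definition Zhat_unit (e : steinitz) (a : nat -> nat) : Prop :=
  (forall d, steinitz_dvd d e -> coprime (a d) d) /\
  (forall d d', steinitz_dvd d' e -> (d %| d')%N -> a d' = a d %[mod d]).

Definition is_kalg (k : comPzRingType) (R : pzRingType) (phi : k -> R) : Prop :=
  (forall x y, phi (x + y) = phi x + phi y) /\
  (forall x y, phi (x * y) = phi x * phi y) /\ phi 1 = 1 /\
  (forall c r, phi c * r = r * phi c).

(* R' = R (x)_Z Z[mu_e] : a ring T with maps i1 : R -> T (r |-> r (x) 1) and
   j : C -> T (used on Z[mu_e], z |-> 1 (x) z), with r (x) z = i1 r * j z,
   satisfying the universal property of the tensor product of abelian groups,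
   and with the ring structure of the tensor product of rings. *)
Definition is_tensor (e : steinitz) (R T : pzRingType) (i1 : R -> T) (j : algC -> T)
  : Prop :=
  (forall x y, i1 (x + y) = i1 x + i1 y) /\
  (forall x y, i1 (x * y) = i1 x * i1 y) /\ i1 1 = 1 /\
  (forall x y, Zmu e x -> Zmu e y -> j (x + y) = j x + j y) /\
  (forall x y, Zmu e x -> Zmu e y -> j (x * y) = j x * j y) /\ j 1 = 1 /\
  (forall r z, Zmu e z -> i1 r * j z = j z * i1 r) /\
  (forall (M : zmodType) (beta : R -> algC -> M),
     (forall r r' z, Zmu e z -> beta (r + r') z = beta r z + beta r' z) ->
     (forall r z z', Zmu e z -> Zmu e z' -> beta r (z + z') = beta r z + beta r z') ->
     (exists phi : T -> M, (forall x y, phi (x + y) = phi x + phi y) /\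
        (forall r z, Zmu e z -> phi (i1 r * j z) = beta r z)) /\
     (forall phi psi : T -> M,
        (forall x y, phi (x + y) = phi x + phi y) ->
        (forall x y, psi (x + y) = psi x + psi y) ->
        (forall r z, Zmu e z -> phi (i1 r * j z) = beta r z) ->
        (forall r z, Zmu e z -> psi (i1 r * j z) = beta r z) ->
        forall x, phi x = psi x)).

(* A = Aut_{k'-alg}(R'), k' = k (x) Z[mu_e] acting on R' through
   c (x) z |-> i1 (phi c) * j z *)
Definition isAut (e : steinitz) (k : comPzRingType) (R T : pzRingType)
  (phi : k -> R) (i1 : R -> T) (j : algC -> T) (s : T -> T) : Prop :=
  bijective s /\
  (forall x y, s (x + y) = s x + s y) /\
  (forall x y, s (x * y) = s x * s y) /\ s 1 = 1 /\
  (forall c z x, Zmu e z -> s (i1 (phi c) * j z * x) = i1 (phi c) * j z * s x).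

Definition eigen (T : pzRingType) (j : algC -> T) (f : T -> T) (zeta : algC) (x : T)
  : Prop := f x = j zeta * x.

Definition mu_diag (e : steinitz) (T : pzRingType) (j : algC -> T) (f : T -> T) : Prop :=
  (forall x : T, exists (s : seq algC) (y : algC -> T),
      uniq s /\ (forall z, z \in s -> mu e z /\ eigen j f z (y z)) /\
      x = \sum_(z <- s) y z) /\
  (forall (s : seq algC) (y : algC -> T),
      uniq s -> (forall z, z \in s -> mu e z /\ eigen j f z (y z)) ->
      \sum_(z <- s) y z = 0 -> forall z, z \in s -> y z = 0).

(* g is f^a : it acts on M(f, zeta) by zeta^a  (zeta^a = zeta ^+ a d for any
   d | e with zeta ^+ d = 1) *)
Definition is_pow (e : steinitz) (T : pzRingType) (j : algC -> T) (f : T -> T)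
  (a : nat -> nat) (g : T -> T) : Prop :=
  (forall x y, g (x + y) = g x + g y) /\
  forall (zeta : algC) (d : nat), steinitz_dvd d e -> zeta ^+ d = 1 ->
    forall x, eigen j f zeta x -> g x = j (zeta ^+ a d) * x.

Definition is_tau (e : steinitz) (R T : pzRingType) (i1 : R -> T) (j : algC -> T)
  (a : nat -> nat) (t : T -> T) : Prop :=
  (forall x y, t (x + y) = t x + t y) /\
  (forall x y, t (x * y) = t x * t y) /\
  (forall r, t (i1 r) = i1 r) /\
  (forall (zeta : algC) (d : nat), steinitz_dvd d e -> zeta ^+ d = 1 ->
     t (j zeta) = j (zeta ^+ a d)).

Definition Xe (e : steinitz) (k : comPzRingType) (R T : pzRingType)
  (phi : k -> R) (i1 : R -> T) (j : algC -> T) (s : T -> T) : Prop :=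
  isAut e phi i1 j s /\ mu_diag e j s /\
  forall a : nat -> nat, Zhat_unit e a ->
    forall t : T -> T, is_tau e i1 j a t ->
    forall g : T -> T, is_pow e j s a g ->
    (* tau_a s tau_a^{-1} = s^a *)
    forall x, t (s x) = g (t x).

Definition is_subgroup_A (e : steinitz) (k : comPzRingType) (R T : pzRingType)
  (phi : k -> R) (i1 : R -> T) (j : algC -> T) (X : (T -> T) -> Prop) : Prop :=
  (forall s, X s -> isAut e phi i1 j s) /\
  X id /\
  (forall s t, X s -> X t -> X (s \o t)) /\
  (forall s, X s -> exists2 s', X s' & cancel s s' /\ cancel s' s).

Definition abelian_set (T : Type) (X : (T -> T) -> Prop) : Prop :=
  forall s t, X s -> X t -> forall x, s (t x) = t (s x).

(* compact-open topology on A (R' discrete): subbase {f in A : f x = y}.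
   U is open in A iff every f in A with U f has a basic neighbourhood
   {g in A : g x_i = f x_i, i = 1..n} contained in U. *)
Definition openA (e : steinitz) (k : comPzRingType) (R T : pzRingType)
  (phi : k -> R) (i1 : R -> T) (j : algC -> T) (U : (T -> T) -> Prop) : Prop :=
  forall f, isAut e phi i1 j f -> U f ->
    exists xs : seq T, forall g, isAut e phi i1 j g ->
      (forall x, x \in xs -> g x = f x) -> U g.

Definition compactA (e : steinitz) (k : comPzRingType) (R T : pzRingType)
  (phi : k -> R) (i1 : R -> T) (j : algC -> T) (X : (T -> T) -> Prop) : Prop :=
  forall (I : Type) (U : I -> (T -> T) -> Prop),
    (forall i, openA e phi i1 j (U i)) ->
    (forall f, X f -> exists i, U i f) ->
    exists l : list I, forall f, X f -> exists i, List.In i l /\ U i f.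

Definition etorsion (e : steinitz) (G : zmodType) : Prop :=
  forall g : G, exists d, steinitz_dvd d e /\ g *+ d = 0.

Definition is_grading (k : comPzRingType) (R : pzRingType) (phi : k -> R)
  (G : zmodType) (Rg : G -> R -> Prop) : Prop :=
  (forall g, Rg g 0 /\ (forall x y, Rg g x -> Rg g y -> Rg g (x + y)) /\
             (forall c x, Rg g x -> Rg g (phi c * x))) /\
  (forall r : R, exists (s : seq G) (y : G -> R),
      uniq s /\ (forall g, g \in s -> Rg g (y g)) /\ r = \sum_(g <- s) y g) /\
  (forall (s : seq G) (y : G -> R), uniq s -> (forall g, g \in s -> Rg g (y g)) ->
      \sum_(g <- s) y g = 0 -> forall g, g \in s -> y g = 0) /\
  Rg 0 1 /\
  (forall g h x y, Rg g x -> Rg h y -> Rg (g + h) (x * y)).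

Definition push (R : pzRingType) (G H : zmodType) (f : G -> H) (Rg : G -> R -> Prop)
  (d : H) (r : R) : Prop :=
  exists (s : seq G) (y : G -> R),
    (forall g, g \in s -> f g = d /\ Rg g (y g)) /\ r = \sum_(g <- s) y g.

Definition universal_grading (e : steinitz) (k : comPzRingType) (R : pzRingType)
  (phi : k -> R) (G0 : zmodType) (Rg0 : G0 -> R -> Prop) : Prop :=
  etorsion e G0 /\ is_grading phi Rg0 /\
  forall (G : zmodType) (Rg : G -> R -> Prop), etorsion e G -> is_grading phi Rg ->
    exists f : G0 -> G,
      ((forall x y, f (x + y) = f x + f y) /\
       (forall d r, push f Rg0 d r <-> Rg d r)) /\
      (forall f' : G0 -> G, (forall x y, f' (x + y) = f' x + f' y) ->
         (forall d r, push f' Rg0 d r <-> Rg d r) -> forall x, f' x = f x).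

Definition has_universal_grading (e : steinitz) (k : comPzRingType) (R : pzRingType)
  (phi : k -> R) : Prop :=
  exists (G0 : zmodType) (Rg0 : G0 -> R -> Prop), universal_grading e phi Rg0.

(* Main.v *)
(* A grading of R by an e-torsion group G and a character c : G -> mu_e give the automorphism
   of R' acting on R_g (x) Z[mu_e] as c(g); it lies in X_e(R).  Conversely, for s in X_e(R)
   the eigenspaces of s are stable under every tau_a; by Galois descent, where one divides
   only by integers dividing e, they come from R, so that s is a mu_e-grading of R.
   If (G0, R_g) is universal, X_e(R) is therefore Hom(G0, mu_e), which is abelian, and compact
   because it is closed in a product of finite sets.  If X_e(R) is an abelian compact group,
   its orbits on R' are finite, so R is the direct sum of the weight spaces of X_e(R); the
   group of functions on X_e(R) generated by the weights carries the universal grading: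
   for another grading by G, the image of a weight f is the g with c(g) = f(s_c) for all
   characters c of G, unique since characters separate the points of an e-torsion group. *)
From HB Require Import structures.
Require Import Defs.
From mathcomp Require Import all_boot all_order all_algebra all_field.
From mathcomp Require Import boolp classical_sets functions filter.
Set Implicit Arguments. Unset Strict Implicit. Unset Printing Implicit Defensive.
Import Order.TTheory GRing.Theory Num.Theory.
Local Open Scope ring_scope.

(** The ring [T] is known only by its universal property, so facts about it come from maps out of
    it, often into quotients built for the purpose by [zmod_quotient].

    The integers dividing e need not be invertible in R, so neither the projections onto eigenspaces
    nor the descent to R can be had by averaging over roots of unity or Galois conjugates. Two
    devices replace this. For independence of eigenvectors: u x = x with u^d = 1 and u != 1 gives d
    x = (1 + u + ... + u^(d-1)) x = 0, and R' inherits from R the injectivity of multiplication by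
    d. For descent of an invariant x: Z[mu_n] contains an element c of trace n all of whose
    multiples have trace in n Z, so that n x becomes n times an element of R and a single
    cancellation of n remains.

    Compactness enters the converse through finite orbits alone. They turn the simultaneous
    diagonalization of the commuting family X_e(R) into finitely many steps for each element of R,
    and they make each weight e-torsion. Only weights of nonzero elements are taken as generators:
    this forces the homomorphism to another grading to be unique. *)

Lemma zmod_quotient (V : zmodType) (S : V -> Prop) :
  S 0 -> (forall x y, S x -> S y -> S (x - y)) ->
  exists (Q : zmodType) (q : V -> Q),
    (forall x y, q (x + y) = q x + q y) /\ (forall x, q x = 0 <-> S x).
Proof.
move=> S0 SB; pose I : {pred V} := fun x => `[< S x >].
have IP : zmod_closed I.
  by split=> [|x y /asboolP Sx /asboolP Sy]; apply/asboolP => //; apply: SB.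
pose kI : zmodClosed V := HB.pack I (GRing.isZmodClosed.Build V I IP).
exists {ideal_quot kI}%type, (\pi_({ideal_quot kI}))%qT.
split=> [x y|x]; first by rewrite raddfD.
have -> : (\pi_({ideal_quot kI})%qT x = 0) <-> x \in kI.
  rewrite -[x in x \in _]subr0 Quotient.idealrBE.
  by rewrite -(raddf0 (\pi_({ideal_quot kI}))%qT); split=> [->|/eqP].
by split=> [/asboolP|Sx] //; apply/asboolP.
Qed.

(** * Additive maps given as plain functions *)

Section AdditiveMap.
Variables (U V : zmodType) (f : U -> V).
Hypothesis fD : forall x y, f (x + y) = f x + f y.

Lemma additive0 : f 0 = 0.
Proof. by apply: (addrI (f 0)); rewrite -fD !addr0. Qed.

Lemma additiveN x : f (- x) = - f x.
Proof. by apply/eqP; rewrite -addr_eq0 -fD addNr additive0. Qed.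

Lemma additiveB x y : f (x - y) = f x - f y.
Proof. by rewrite fD additiveN. Qed.

Lemma additive_sum (I : Type) (s : seq I) (P : pred I) (F : I -> U) :
  f (\sum_(i <- s | P i) F i) = \sum_(i <- s | P i) f (F i).
Proof. exact: (big_morph f fD additive0). Qed.

Lemma additiveMn x n : f (x *+ n) = f x *+ n.
Proof. by elim: n => [|n IH]; rewrite ?mulr0n ?additive0 // !mulrS fD IH. Qed.

Lemma additiveMz x (n : int) : f (x *~ n) = f x *~ n.
Proof.
by case: n => n; rewrite ?NegzE ?mulrNz ?additiveN -!pmulrn additiveMn.
Qed.

End AdditiveMap.

(** * Steinitz numbers, mu_e and the ring Z[mu_e] *)

Section Steinitz.
Variable e : steinitz.

Lemma steinitz_dvd1 : steinitz_dvd 1 e.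
Proof. by split=> // p _; rewrite logn1; case: (e p). Qed.

Lemma steinitz_dvd_gt0 d : steinitz_dvd d e -> (0 < d)%N. Proof. by case. Qed.

Lemma steinitz_dvd_lcm d n :
  steinitz_dvd d e -> steinitz_dvd n e -> steinitz_dvd (lcmn d n) e.
Proof.
move=> [d0 de] [n0 ne]; split=> [|p pp]; first by rewrite lcmn_gt0 d0.
move: (de p pp) (ne p pp); case: (e p) => // m dm nm.
by rewrite logn_lcm // geq_max dm nm.
Qed.

Lemma mu1 : mu e 1.
Proof. by exists 1%N; split; [apply: steinitz_dvd1|rewrite expr1]. Qed.

Lemma muM z w : mu e z -> mu e w -> mu e (z * w).
Proof.
move=> [d [de zd]] [n [ne wn]]; exists (lcmn d n); split.
  exact: steinitz_dvd_lcm.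
by rewrite exprMn (expr_dvd zd (dvdn_lcml _ _)) (expr_dvd wn (dvdn_lcmr _ _)) mulr1.
Qed.

Lemma muV z : mu e z -> mu e z^-1.
Proof. by case=> d [de zd]; exists d; split=> //; rewrite exprVn zd invr1. Qed.

Lemma muX z n : mu e z -> mu e (z ^+ n).
Proof. by case=> d [de zd]; exists d; split=> //; rewrite exprAC zd expr1n. Qed.

Lemma mu_neq0 z : mu e z -> z != 0.
Proof.
case=> d [[d0 _] zd]; apply: contra_eqN zd => /eqP->.
by rewrite expr0n gtn_eqF // eq_sym oner_eq0.
Qed.

Lemma mu_common_order (s : seq algC) : (forall z, z \in s -> mu e z) ->
  exists d, steinitz_dvd d e /\ forall z, z \in s -> z ^+ d = 1.
Proof.
elim: s => [|z s IH] sm; first by exists 1%N; split=> //; apply: steinitz_dvd1.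
have [|d [de dP]] := IH; first by move=> w ws; apply: sm; rewrite inE ws orbT.
have [|n [ne zn]] := sm z; first by rewrite inE eqxx.
exists (lcmn d n); split=> [|w]; first exact: steinitz_dvd_lcm.
rewrite inE => /orP[/eqP->|/dP wd]; first exact: expr_dvd zn (dvdn_lcmr _ _).
exact: expr_dvd wd (dvdn_lcml _ _).
Qed.

Lemma Zmu_mu z : mu e z -> Zmu e z.
Proof. by move=> zm S _ _ _; apply. Qed.

Lemma Zmu1 : Zmu e 1. Proof. exact: Zmu_mu mu1. Qed.

Lemma ZmuB x y : Zmu e x -> Zmu e y -> Zmu e (x - y).
Proof.
move=> xE yE S S1 SB SM Sm.
exact: (SB _ _ (xE S S1 SB SM Sm) (yE S S1 SB SM Sm)). Qed.

Lemma ZmuM x y : Zmu e x -> Zmu e y -> Zmu e (x * y).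
Proof.
move=> xE yE S S1 SB SM Sm.
exact: (SM _ _ (xE S S1 SB SM Sm) (yE S S1 SB SM Sm)). Qed.

Lemma Zmu0 : Zmu e 0. Proof. by rewrite -(subrr 1); apply: ZmuB; apply: Zmu1. Qed.

Lemma ZmuN x : Zmu e x -> Zmu e (- x).
Proof. by rewrite -sub0r; apply: ZmuB; apply: Zmu0. Qed.

Lemma ZmuD x y : Zmu e x -> Zmu e y -> Zmu e (x + y).
Proof. by move=> xE yE; rewrite -[y]opprK; apply: ZmuB => //; apply: ZmuN. Qed.

Lemma Zmu_sum (I : eqType) (s : seq I) (P : pred I) (F : I -> algC) :
  (forall i, i \in s -> P i -> Zmu e (F i)) -> Zmu e (\sum_(i <- s | P i) F i).
Proof.
rewrite big_seq_cond => sE; apply: (big_ind (Zmu e)) => [|x y|i /andP[]].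
- exact: Zmu0.
- exact: ZmuD.
- exact: sE.
Qed.

Lemma Zmu_prod (I : eqType) (s : seq I) (P : pred I) (F : I -> algC) :
  (forall i, i \in s -> P i -> Zmu e (F i)) -> Zmu e (\prod_(i <- s | P i) F i).
Proof.
rewrite big_seq_cond => sE; apply: (big_ind (Zmu e)) => [|x y|i /andP[]].
- exact: Zmu1.
- exact: ZmuM.
- exact: sE.
Qed.

Lemma Zmu_nat n : Zmu e n%:R.
Proof.
elim: n => [|n IH]; first exact: Zmu0.
by rewrite mulrS; apply: ZmuD => //; apply: Zmu1.
Qed.

Lemma Zmu_Mz x (n : int) : Zmu e x -> Zmu e (x *~ n).
Proof.
have ZmuMn m : Zmu e x -> Zmu e (x *+ m).
  by move=> xE; elim: m => [|m IH]; rewrite ?mulrS; [apply: Zmu0|apply: ZmuD].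
move=> xE; case: n => n; rewrite ?NegzE ?mulrNz -?pmulrn; last apply: ZmuN.
  exact: ZmuMn.
exact: ZmuMn.
Qed.

End Steinitz.

(** With an integer viewed as a Steinitz number, Z[mu_n] is [Zmu (nat_steinitz n)] and the lemmas
    above apply at each finite level. *)
Definition nat_steinitz (n : nat) : steinitz := fun p => Some (logn p n).

Lemma nat_steinitz_dvd n d : (0 < n)%N -> steinitz_dvd d (nat_steinitz n) <-> (d %| n)%N.
Proof.
move=> n0; split=> [[d0 dP]|dn]; last first.
  by split=> [|p _]; [apply: dvdn_gt0 dn|apply: dvdn_leq_log].
apply/dvdn_partP => // p; rewrite mem_primes => /andP[pp _].
by rewrite p_part pfactor_dvdn //; apply: dP.
Qed.

Lemma mu_nat_steinitz n z : (0 < n)%N -> mu (nat_steinitz n) z <-> z ^+ n = 1.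
Proof.
move=> n0; split=> [[d [/(nat_steinitz_dvd _ n0) dn zd]]|zn]; first exact: expr_dvd zd dn.
by exists n; split=> //; apply/nat_steinitz_dvd.
Qed.

Lemma Zmu_mono (e1 e2 : steinitz) z :
  (forall w, mu e1 w -> mu e2 w) -> Zmu e1 z -> Zmu e2 z.
Proof.
move=> sub; apply; [exact: Zmu1 | exact: ZmuB | exact: ZmuM |].
by move=> w /sub; apply: Zmu_mu.
Qed.

Lemma Zmu_nat_steinitz_sub n e z : steinitz_dvd n e -> Zmu (nat_steinitz n) z -> Zmu e z.
Proof.
move=> ne; apply: Zmu_mono => w /mu_nat_steinitz wn.
by exists n; split=> //; apply/wn/(steinitz_dvd_gt0 ne).
Qed.

Lemma Zmu_nat_steinitz_dvd d n z : (0 < n)%N -> (d %| n)%N -> Zmu (nat_steinitz d) z -> Zmu (nat_steinitz n) z.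
Proof. by move=> n0 dn; apply: Zmu_nat_steinitz_sub; apply/nat_steinitz_dvd. Qed.

(** Z[mu_e] is the directed union of the Z[mu_n] with n dividing e: least common multiples keep the
    levels directed, so the union is a ring containing mu_e. *)
Lemma Zmu_level e z : Zmu e z -> exists n, steinitz_dvd n e /\ Zmu (nat_steinitz n) z.
Proof.
pose S x := exists n, steinitz_dvd n e /\ Zmu (nat_steinitz n) x.
have S2 x y : S x -> S y ->
    exists n, [/\ steinitz_dvd n e, Zmu (nat_steinitz n) x & Zmu (nat_steinitz n) y].
  move=> [d [de xd]] [n [ne yn]]; have dne := steinitz_dvd_lcm de ne.
  exists (lcmn d n); split=> //; apply: Zmu_nat_steinitz_dvd (steinitz_dvd_gt0 dne) _ _.
  - exact: dvdn_lcml.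
  - exact: xd.
  - exact: dvdn_lcmr.
  - exact: yn.
apply: (_ : _ -> S z); apply.
- by exists 1%N; split; [apply: steinitz_dvd1|apply: Zmu1].
- by move=> x y xS /(S2 _ _ xS)[n [ne xn yn]]; exists n; split=> //; apply: ZmuB.
- by move=> x y xS /(S2 _ _ xS)[n [ne xn yn]]; exists n; split=> //; apply: ZmuM.
- move=> w [d [de wd]]; exists d; split=> //; apply: Zmu_mu.
  by apply/(mu_nat_steinitz _ (steinitz_dvd_gt0 de)).
Qed.

(** Z[mu_n] is Z[X] / Phi_n, and [P z] is the representative of z of degree below [totient n]. Its
    uniqueness gives additivity and [P 1 = 1]. *)
Lemma cyclotomic_coordinates n : (0 < n)%N ->
  exists (w : algC) (P : algC -> {poly int}),
   [/\ w ^+ n = 1,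
       forall z, Zmu (nat_steinitz n) z -> (map_poly intr (P z)).[w] = z,
       forall x y, Zmu (nat_steinitz n) x -> Zmu (nat_steinitz n) y -> P (x + y) = P x + P y
     & P 1 = 1].
Proof.
move=> n0; have [w w_prim] := C_prim_root_exists n0; exists w.
have wn := prim_expr_order w_prim.
pose ev (p : {poly int}) : algC := (map_poly intr p).[w].
have evB p q : ev (p - q) = ev p - ev q by rewrite /ev rmorphB hornerD hornerN.
have evD p q : ev (p + q) = ev p + ev q by rewrite /ev rmorphD hornerD.
have evM p q : ev (p * q) = ev p * ev q by rewrite /ev rmorphM hornerM.
have ev_Phi : ev 'Phi_n = 0.
  by apply/rootP; rewrite (Cintr_Cyclotomic w_prim) root_cyclotomic.
pose Q (z : algC) (p : {poly int}) := (size p <= totient n)%N /\ ev p = z.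
have Qex z : Zmu (nat_steinitz n) z -> exists p, Q z p.
  move=> zE; have [p <-] : exists p, ev p = z; last first.
    exists (Pdiv.Ring.rmodp p 'Phi_n); split.
      rewrite -ltnS -(size_Cyclotomic n).
      by rewrite Pdiv.Ring.ltn_rmodp monic_neq0 ?Cyclotomic_monic.
    rewrite {2}(Pdiv.RingMonic.rdivp_eq (Cyclotomic_monic n) p).
    by rewrite evD evM ev_Phi mulr0 add0r.
  apply: (zE (fun z => exists p, ev p = z)).
  - by exists 1; rewrite /ev rmorph1 hornerC.
  - by move=> _ _ [p <-] [q <-]; exists (p - q).
  - by move=> _ _ [p <-] [q <-]; exists (p * q).
  - move=> x /(mu_nat_steinitz _ n0) xn; have [i ->] := prim_rootP w_prim xn.
    by exists ('X^i); rewrite /ev rmorphXn /= map_polyX hornerXn.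
(* Phi_n is the minimal polynomial of w over the rationals, and p - q is too short to be a nonzero
   multiple of it. *)
have Qinj (p q : {poly int}) : (size p <= totient n)%N -> (size q <= totient n)%N ->
    ev p = ev q -> p = q.
  move=> sp sq epq; apply/eqP; rewrite -subr_eq0; apply/contraT => pq0.
  have : root (map_poly intr (p - q)) w by apply/rootP; rewrite -/(ev _) evB epq subrr.
  have -> : map_poly intr (p - q) = map_poly ratr (map_poly intr (p - q)) :> {poly algC}.
    by rewrite -map_poly_comp; apply: eq_map_poly => i /=; rewrite ratr_int.
  have [m [Dm m_monic] ->] := minCpolyP w => /dvdp_leq.
  rewrite -size_poly_eq0 !(size_map_inj_poly (@intr_inj _)) // size_poly_eq0 => /(_ pq0).
  rewrite -(size_map_poly (@ratr algC)) -Dm (minCpoly_cyclotomic w_prim).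
  rewrite size_cyclotomic ltnNge (leq_trans (size_polyD _ _)) // size_polyN.
  by rewrite geq_max sp.
have [P PQ] : {P | forall z, Zmu (nat_steinitz n) z -> Q z (P z)}.
  have [z|P] := @choice algC {poly int} (fun z p => Zmu (nat_steinitz n) z -> Q z p); last by exists P.
  by have [/Qex[p Qp]|nz] := pselect (Zmu (nat_steinitz n) z); [exists p|exists 0].
exists P; split=> // [z /PQ[]//|x y xE yE|].
  have [[sx ex] [sy ey]] := (PQ _ xE, PQ _ yE); have [sxy exy] := PQ _ (ZmuD xE yE).
  apply: Qinj => //; first by rewrite (leq_trans (size_polyD _ _)) // geq_max sx.
  by rewrite exy evD ex ey.
have [s1 e1] := PQ _ (@Zmu1 _); apply: Qinj => //.
  by rewrite size_poly1 totient_gt0.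
by rewrite e1 /ev rmorph1 hornerC.
Qed.

(** * Galois action on Z[mu_e] *)

Section ZhatUnits.
Variable e : steinitz.

Lemma expr_eq_mod (z : algC) d a b : z ^+ d = 1 -> a = b %[mod d] -> z ^+ a = z ^+ b.
Proof. by move=> zd ab; rewrite -(expr_mod a zd) ab expr_mod. Qed.

Lemma Zhat_unit_pow a (z : algC) d n : Zhat_unit e a ->
  steinitz_dvd d e -> steinitz_dvd n e -> z ^+ d = 1 -> z ^+ n = 1 ->
  z ^+ a d = z ^+ a n.
Proof.
move=> [_ a_compat] de ne zd zn; have dne := steinitz_dvd_lcm de ne.
transitivity (z ^+ a (lcmn d n)); first apply/esym.
  by apply: (expr_eq_mod zd); apply: a_compat => //; apply: dvdn_lcml.
by apply: (expr_eq_mod zn); apply: a_compat => //; apply: dvdn_lcmr.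
Qed.

(** A Bezout inverse of [a d] modulo d undoes the exponentiation on mu_d. *)
Lemma Zhat_unit_pow_inj a (z w : algC) d : Zhat_unit e a -> steinitz_dvd d e ->
  z ^+ d = 1 -> w ^+ d = 1 -> z ^+ a d = w ^+ a d -> z = w.
Proof.
move=> [a_unit _] de zd wd zw; have d0 := steinitz_dvd_gt0 de.
have [|a0] := posnP (a d).
  move=> ad0; have := a_unit _ de; rewrite ad0 /coprime gcd0n => /eqP d1.
  by rewrite -[z]expr1 -[w]expr1 -d1 zd wd.
have := a_unit _ de; rewrite /coprime.
have [b c bc _ ] := egcdnP d a0; move=> /eqP gad; rewrite gad in bc.
suff h (x : algC) : x ^+ d = 1 -> x = (x ^+ a d) ^+ b by rewrite (h z) // (h w) // zw.
by move=> xd; rewrite -exprM mulnC bc exprD mulnC exprM xd expr1n mul1r expr1.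
Qed.

(** Residues modulo n lift to units of Zhat / e Zhat: modulo d the lift is a on the part of d
    supported at the primes of n, and 1 on the part prime to n. *)
Lemma Zhat_unit_lift n a : (0 < n)%N -> coprime a n ->
  exists b, Zhat_unit e b /\ b n = a %[mod n].
Proof.
move=> n0 an; pose pi : nat_pred := \pi(n).
(* [a + n] stands for a because the criterion by prime supports wants a positive number, and a may
   be 0 when n = 1. *)
pose b d := chinese d`_pi d`_pi^' (a + n) 1.
have co d : coprime d`_pi d`_pi^' by apply: coprime_partC.
have bl d : b d = a + n %[mod d`_pi] by apply: chinese_modl.
have br d : b d = 1 %[mod d`_pi^'] by apply: chinese_modr.
have eqmod d x y : (0 < d)%N -> x = y %[mod d`_pi] -> x = y %[mod d`_pi^'] -> x = y %[mod d].
  move=> d0 /eqP xl /eqP xr; apply/eqP; rewrite -(partnC pi d0).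
  by rewrite chinese_remainder ?xl ?co.
have modd d' d x y : (d %| d')%N -> x = y %[mod d'] -> x = y %[mod d].
  by move=> dd' xy; rewrite -(modn_dvdm x dd') xy modn_dvdm.
have copr m x y : x = y %[mod m] -> coprime m y -> coprime x m.
  by move=> xy; rewrite -coprime_modr -xy coprime_modr coprime_sym.
exists b; split; first split.
- move=> d de; have d0 := steinitz_dvd_gt0 de.
  rewrite -{2}(partnC pi d0) coprimeMr (copr _ _ _ (bl d)) /=; last first.
    have a0 : (0 < a + n)%N by rewrite addn_gt0 n0 orbT.
    apply: (pnat_coprime (part_pnat pi d)); rewrite -coprime_pi' // coprime_sym.
    by rewrite -coprime_modl modnDr coprime_modl.
  by apply: copr (br d) _; rewrite coprimen1.
- move=> d d' de dd'; have d'0 := steinitz_dvd_gt0 de.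
  have d0 := dvdn_gt0 d'0 dd'.
  apply: eqmod => //.
    by rewrite bl; apply: (modd _ _ _ _ (partn_dvd pi d'0 dd')); rewrite bl.
  by rewrite br; apply: (modd _ _ _ _ (partn_dvd pi^' d'0 dd')); rewrite br.
- by have := bl n; rewrite part_pnat_id ?pnat_pi // modnDr.
Qed.

Lemma Zmu_rmorph_eq n (u v : {rmorphism algC -> algC}) z : (0 < n)%N ->
  (forall w, w ^+ n = 1 -> u w = v w) -> Zmu (nat_steinitz n) z -> u z = v z.
Proof.
move=> n0 uv zE; apply: (zE (fun z => u z = v z)) => [|x y|x y|w].
- by rewrite !rmorph1.
- by rewrite !rmorphB => -> ->.
- by rewrite !rmorphM => -> ->.
- by case/(mu_nat_steinitz _ n0)/uv.
Qed.

(** At each level n an automorphism of [algC] raises n-th roots of unity to the power [a n]. These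
    need not agree on [algC], but they agree on each Z[mu_n], as a comparison at the lcm of two
    levels shows; u is the map glued from them. *)
Lemma Zhat_unit_galois a : Zhat_unit e a -> exists u : algC -> algC,
  [/\ forall z, Zmu e z -> Zmu e (u z),
      forall x y, Zmu e x -> Zmu e y -> u (x + y) = u x + u y,
      forall x y, Zmu e x -> Zmu e y -> u (x * y) = u x * u y
    & forall z d, steinitz_dvd d e -> z ^+ d = 1 -> u z = z ^+ a d].
Proof.
move=> a_unit.
(* The identity is a default for n where [a n] is not prime to n; this does not happen for n
   dividing e. *)
pose V n := if pselect (coprime (a n) n) is left co then sval (Qn_aut_exists co) else idfun.
have VP n w : steinitz_dvd n e -> w ^+ n = 1 -> V n w = w ^+ a n.
  rewrite /V => ne wn; case: pselect => [co|[]]; last by apply: a_unit.1.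
  by case: (Qn_aut_exists co) => u /= ->.
have [N NP] : {N | forall z, Zmu e z -> steinitz_dvd (N z) e /\ Zmu (nat_steinitz (N z)) z}.
  have [z|N] := @choice algC nat (fun z n => Zmu e z -> steinitz_dvd n e /\ Zmu (nat_steinitz n) z); last by exists N.
  by have [/Zmu_level[n nP]|nz] := pselect (Zmu e z); [exists n|exists 0%N].
pose u z := V (N z) z.
have uV n z : steinitz_dvd n e -> Zmu (nat_steinitz n) z -> u z = V n z.
  move=> ne zn; have [Ne zN] := NP z (Zmu_nat_steinitz_sub ne zn).
  have le := steinitz_dvd_lcm Ne ne; have l0 := steinitz_dvd_gt0 le.
  transitivity (V (lcmn (N z) n) z); [|symmetry].
    apply: Zmu_rmorph_eq zN => [|w wn]; first exact: steinitz_dvd_gt0 Ne.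
    have wl := expr_dvd wn (dvdn_lcml _ n).
    by rewrite !VP //; apply: Zhat_unit_pow.
  apply: Zmu_rmorph_eq zn => [|w wn]; first exact: steinitz_dvd_gt0 ne.
  have wl := expr_dvd wn (dvdn_lcmr (N z) _).
  by rewrite !VP //; apply: Zhat_unit_pow.
have common x y : Zmu e x -> Zmu e y ->
    exists n, [/\ steinitz_dvd n e, Zmu (nat_steinitz n) x & Zmu (nat_steinitz n) y].
  move=> /Zmu_level[d [de xd]] /Zmu_level[n [ne yn]].
  have dne := steinitz_dvd_lcm de ne; have dn0 := steinitz_dvd_gt0 dne.
  exists (lcmn d n); split=> //.
    exact: Zmu_nat_steinitz_dvd (dvdn_lcml _ _) xd.
  exact: Zmu_nat_steinitz_dvd (dvdn_lcmr _ _) yn.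
exists u; split.
- move=> z /Zmu_level[n [ne zn]]; rewrite (uV n) //; have n0 := steinitz_dvd_gt0 ne.
  apply: (zn (fun z => Zmu e (V n z))); first by rewrite rmorph1; apply: Zmu1.
  + by move=> x y; rewrite rmorphB; apply: ZmuB.
  + by move=> x y; rewrite rmorphM; apply: ZmuM.
  + move=> w /(mu_nat_steinitz _ n0) wn; rewrite VP //; apply: Zmu_mu; apply: muX.
    by exists n.
- move=> x y xE yE; have [n [ne xn yn]] := common _ _ xE yE.
  by rewrite !(uV n) ?rmorphD //; apply: ZmuD.
- move=> x y xE yE; have [n [ne xn yn]] := common _ _ xE yE.
  by rewrite !(uV n) ?rmorphM //; apply: ZmuM.
- move=> z d de zd; rewrite (uV d) ?VP //; apply: Zmu_mu.
  by apply/(mu_nat_steinitz _ (steinitz_dvd_gt0 de)).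
Qed.

End ZhatUnits.

(** * An element of Z[mu_n] of trace n whose multiples have trace in n Z *)

Section DualTrace.
Variables (n : nat) (w : algC).
Hypotheses (n0 : (0 < n)%N) (w_prim : n.-primitive_root w).

Let y (p : nat) : algC := w ^+ (n %/ p).

(* The a-th conjugate of c = prod_(p | n) (1 - zeta_p).  It vanishes unless a is prime to n, so
   traces of multiples of c are sums over all a < n; they lie in n Z, and c itself has trace n. *)
Definition cyclo_dual (a : nat) : algC := \prod_(p <- primes n) (1 - y p ^+ a).

(** The sum runs over all residues a, so that for empty s it is n or 0 by orthogonality. Expanding
    the product one prime at a time by [F_cons] writes every value as a signed sum of such terms. *)
Let F (s : seq nat) (z : algC) : algC :=
  \sum_(a < n) \prod_(p <- s) (1 - y p ^+ a) * z ^+ a.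

Let yp p : (p %| n)%N -> y p ^+ p = 1.
Proof. by move=> pn; rewrite -exprM divnK // prim_expr_order. Qed.

Let yn p : (p %| n)%N -> y p ^+ n = 1.
Proof. by move=> _; rewrite /y exprAC (prim_expr_order w_prim) // expr1n. Qed.

Let F_nil z : z ^+ n = 1 -> F [::] z = (if z == 1 then n else 0)%:R.
Proof.
move=> zn; rewrite /F; under eq_bigr do rewrite big_nil mul1r.
have [->|z1] := eqVneq z 1.
  by under eq_bigr do rewrite expr1n; rewrite sumr_const card_ord.
apply/eqP; have /eqP := subrX1 z n; rewrite zn subrr eq_sym mulf_eq0 subr_eq0.
by rewrite (negPf z1).
Qed.

Let F_cons p s z : F (p :: s) z = F s z - F s (y p * z).
Proof.
rewrite /F -sumrB; apply: eq_bigr => a _.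
by rewrite big_cons exprMn mulrBl mul1r mulrBl [_ * (_ * _)]mulrCA mulrA.
Qed.

Let F_int s z : all (fun p => p %| n)%N s -> z ^+ n = 1 -> exists m : int, F s z = n%:R *~ m.
Proof.
elim: s z => [|p s IH] z /=.
  move=> _ zn; rewrite F_nil //; exists (z == 1)%:Z.
  by case: eqP; rewrite ?mulr1z.
case/andP=> pn sn zn; rewrite F_cons.
have [m ->] := IH _ sn zn.
have [|m' ->] := IH (y p * z) sn; first by rewrite exprMn yn // zn mulr1.
by exists (m - m'); rewrite mulrzBr.
Qed.

(** The expansion evaluates the orthogonality sum at z times products of the [y p]. These have the
    same power of exponent [\prod_(p <- s) p] as z, so none of them is 1. *)
Let F_eq0 s z : all (fun p => p %| n)%N s -> z ^+ n = 1 ->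
  z ^+ (\prod_(p <- s) p) != 1 -> F s z = 0.
Proof.
elim: s z => [|p s IH] z /=.
  by move=> _ zn; rewrite big_nil expr1 F_nil // => /negPf->.
case/andP=> pn sn zn; rewrite big_cons F_cons => zp.
rewrite !IH ?subrr //; first by rewrite exprMn yn // zn mulr1.
  apply: contra zp => /eqP zp; rewrite mulnC -[X in X == _](_ : (y p * z) ^+ (\prod_(j <- s) j * p)%N = _).
    by rewrite exprM zp expr1n.
  by rewrite exprMn [y p ^+ _]exprM exprAC yp // expr1n mul1r.
by apply: contra zp => /eqP zp; rewrite mulnC exprM zp expr1n.
Qed.

Lemma cyclo_dual_sum z :
  \sum_(a < n | coprime a n) cyclo_dual a * z ^+ a = F (primes n) z.
Proof.
rewrite big_mkcond; apply: eq_bigr => a _ /=; case: ifP => // /negbT aN.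
have [p /andP[/andP[pp pa] pn]] : exists p, prime p && (p %| a)%N && (p %| n)%N.
  (* The residue 0 fails to be prime to n only if n > 1, and then any prime of n serves. *)
  have [a0|a0] := posnP a.
    move: aN; rewrite a0 /coprime gcd0n => n1; have n2 : (1 < n)%N by rewrite ltn_neqAle eq_sym n1.
    by exists (pdiv n); rewrite pdiv_prime // dvdn0 pdiv_dvd.
  move: aN; rewrite coprime_has_primes // negbK => /hasP[p].
  rewrite !mem_primes => /and3P[pp _ pn] /and3P[_ _ pa].
  by exists p; rewrite pp pa pn.
rewrite (big_rem p) ?mem_primes ?pp ?n0 //=.
have -> : y p ^+ a = 1 by case/dvdnP: pa => q ->; rewrite mulnC exprM yp // expr1n.
by rewrite subrr !mul0r.
Qed.

Let primes_dvd : all (fun p => p %| n)%N (primes n).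
Proof. by apply/allP => p; rewrite mem_primes => /and3P[]. Qed.

(** Adding a prime p to s subtracts the value at [y p]. It is 0, since [y p] has order p and p does
    not divide the product of the other primes; so the value n of the empty product persists.
    Together with the next lemma, c / n lies in the inverse different of Z[mu_n] and has trace 1. *)
Lemma cyclo_dual_trace : \sum_(a < n | coprime a n) cyclo_dual a = n%:R.
Proof.
have := cyclo_dual_sum 1; under eq_bigr do rewrite expr1n mulr1.
move=> ->; move: primes_dvd (primes_uniq n).
have : all prime (primes n) by apply/allP => p; rewrite mem_primes => /andP[].
elim: (primes n) => [|p s IH] /=; first by rewrite F_nil ?expr1n // eqxx.
case/andP=> pp sp /andP[pn sn] /andP[ps us]; rewrite F_cons IH // mulr1 F_eq0 ?subr0 ?yn //.
rewrite -(prim_order_dvd (dvdn_prim_root w_prim pn)) Euclid_dvd_prod // big_has.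
apply: contra ps => /hasP[q qs]; have qp := allP sp q qs.
by rewrite dvdn_prime2 // => /eqP->.
Qed.

Lemma cyclo_dual_int z : z ^+ n = 1 ->
  exists m : int, \sum_(a < n | coprime a n) cyclo_dual a * z ^+ a = n%:R *~ m.
Proof. by move=> zn; rewrite cyclo_dual_sum; apply: F_int. Qed.

End DualTrace.

(** * The tensor product R (x) Z[mu_e] *)

Section Tensor.
Variables (e : steinitz) (R T : pzRingType) (i1 : R -> T) (j : algC -> T).
Hypothesis HT : is_tensor e i1 j.

Lemma tensor_i1D x y : i1 (x + y) = i1 x + i1 y. Proof. by case: HT. Qed.
Lemma tensor_i1M x y : i1 (x * y) = i1 x * i1 y. Proof. by case: HT => _ []. Qed.
Lemma tensor_i1_1 : i1 1 = 1. Proof. by case: HT => _ [_ []]. Qed.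
Lemma tensor_jD x y : Zmu e x -> Zmu e y -> j (x + y) = j x + j y.
Proof. by case: HT => _ [_ [_ [+ _]]]; apply. Qed.
Lemma tensor_jM x y : Zmu e x -> Zmu e y -> j (x * y) = j x * j y.
Proof. by case: HT => _ [_ [_ [_ [+ _]]]]; apply. Qed.
Lemma tensor_j1 : j 1 = 1. Proof. by case: HT => _ [_ [_ [_ [_ []]]]]. Qed.
Lemma tensor_comm r z : Zmu e z -> i1 r * j z = j z * i1 r.
Proof. by case: HT => _ [_ [_ [_ [_ [_ [+ _]]]]]]; apply. Qed.

Lemma tensor_map (M : zmodType) (beta : R -> algC -> M) :
  (forall r r' z, Zmu e z -> beta (r + r') z = beta r z + beta r' z) ->
  (forall r z z', Zmu e z -> Zmu e z' -> beta r (z + z') = beta r z + beta r z') ->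
  exists f : T -> M, (forall x y, f (x + y) = f x + f y) /\
    (forall r z, Zmu e z -> f (i1 r * j z) = beta r z).
Proof. by case: HT => _ [_ [_ [_ [_ [_ [_ H]]]]]] bl br; case: (H M beta bl br). Qed.

Lemma tensor_j0 : j 0 = 0.
Proof. by apply: (addrI (j 0)); rewrite -tensor_jD ?addr0 //; apply: Zmu0. Qed.

Lemma tensor_jN z : Zmu e z -> j (- z) = - j z.
Proof.
move=> zE; apply/eqP; rewrite -addr_eq0 -tensor_jD ?addNr ?tensor_j0 //.
exact: ZmuN.
Qed.

Lemma tensor_jB x y : Zmu e x -> Zmu e y -> j (x - y) = j x - j y.
Proof. by move=> xE yE; rewrite tensor_jD ?tensor_jN //; apply: ZmuN. Qed.

Lemma tensor_jMn z n : Zmu e z -> j (z *+ n) = j z *+ n.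
Proof.
move=> zE; suff [] : j (z *+ n) = j z *+ n /\ Zmu e (z *+ n) by [].
elim: n => [|n [IH nE]]; first by split; [apply: tensor_j0|apply: Zmu0].
by rewrite !mulrS tensor_jD // IH; split=> //; apply: ZmuD.
Qed.

Lemma tensor_jMz z (n : int) : Zmu e z -> j (z *~ n) = j z *~ n.
Proof.
move=> zE; case: n => n; rewrite ?NegzE ?mulrNz -!pmulrn.
  exact: tensor_jMn.
rewrite tensor_jN ?tensor_jMn //.
by rewrite pmulrn; apply: Zmu_Mz.
Qed.

Lemma tensor_j_sum (I : eqType) (s : seq I) (P : pred I) (F : I -> algC) :
  (forall i, i \in s -> P i -> Zmu e (F i)) ->
  j (\sum_(i <- s | P i) F i) = \sum_(i <- s | P i) j (F i).
Proof.
elim: s => [|i s IH] sE; first by rewrite !big_nil tensor_j0.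
have sE' k : k \in s -> P k -> Zmu e (F k) by move=> ks; apply: sE; rewrite inE ks orbT.
rewrite !big_cons; case: ifP => Pi; rewrite ?IH //.
rewrite tensor_jD ?IH //; first by apply: sE; rewrite ?inE ?eqxx.
exact: Zmu_sum.
Qed.

(** The quotient map by the subgroup of such sums and the zero map both kill every pure tensor, so
    the uniqueness clause of the universal property identifies them. *)
Lemma tensor_span x : exists l : seq (R * algC),
  (forall p, p \in l -> mu e p.2) /\ x = \sum_(p <- l) i1 p.1 * j p.2.
Proof.
pose S x := exists l : seq (R * algC),
  (forall p, p \in l -> mu e p.2) /\ x = \sum_(p <- l) i1 p.1 * j p.2.
have S0 : S 0 by exists [::]; rewrite big_nil.
have SB u v : S u -> S v -> S (u - v).
  move=> [l [lm ->]] [l' [lm' ->]].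
  exists (l ++ [seq (- p.1, p.2) | p <- l']); split.
    by move=> p; rewrite mem_cat => /orP[/lm//|/mapP[q /lm' qm ->]].
  rewrite big_cat big_map /= -sumrN; congr (_ + _); apply: eq_bigr => p _.
  by rewrite (additiveN tensor_i1D) mulNr.
have Sp z : Zmu e z -> forall r, S (i1 r * j z).
  move=> zE r; have Sr : S (i1 r).
    exists [:: (r, 1)]; rewrite big_seq1 tensor_j1 mulr1; split=> // p.
    by rewrite inE => /eqP->; apply: mu1.
  (* Stability of S under multiplication by [j z] is what passes to products in z; membership of z
     in Z[mu_e] is carried along because [j] is a homomorphism only there. *)
  suff [] : Zmu e z /\ forall x, S x -> S (x * j z) by move=> _ /(_ _ Sr).
  apply: (zE (fun z => Zmu e z /\ forall x, S x -> S (x * j z))).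
  - by split=> [|y]; [apply: Zmu1|rewrite tensor_j1 mulr1].
  - move=> u v [uE uS] [vE vS]; split=> [|y Sy]; first exact: ZmuB.
    by rewrite tensor_jB // mulrBr; apply: SB; [apply: uS|apply: vS].
  - move=> u v [uE uS] [vE vS]; split=> [|y Sy]; first exact: ZmuM.
    by rewrite tensor_jM // mulrA; apply/vS/uS.
  - move=> w wm; split=> [|y [l [lm ->]]]; first exact: Zmu_mu.
    exists [seq (p.1, p.2 * w) | p <- l]; split.
      by move=> p /mapP[q /lm qm ->]; apply: muM.
    rewrite big_map mulr_suml !big_seq; apply: eq_bigr => p /lm pm /=.
    by rewrite tensor_jM ?mulrA //; apply: Zmu_mu.
have [Q [q [qD qS]]] := zmod_quotient S0 SB.
case: HT => _ [_ [_ [_ [_ [_ [_ H]]]]]].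
have [|//|_] := H Q (fun _ _ => 0); rewrite ?addr0 //.
move=> /(_ q (fun=> 0) qD) uniq; apply/qS; apply: uniq; rewrite ?addr0 //.
by move=> r z /Sp zS; apply/qS.
Qed.

Lemma tensor_ext (V : zmodType) (f g : T -> V) :
  (forall x y, f (x + y) = f x + f y) -> (forall x y, g (x + y) = g x + g y) ->
  (forall r z, mu e z -> f (i1 r * j z) = g (i1 r * j z)) -> f =1 g.
Proof.
move=> fD gD fg x; have [l [lm ->]] := tensor_span x.
rewrite (additive_sum fD) (additive_sum gD) !big_seq; apply: eq_bigr => p pl.
by apply: fg; apply: lm.
Qed.

Lemma tensor_central z x : Zmu e z -> j z * x = x * j z.
Proof.
move=> zE; move: x; apply: tensor_ext => [x y|x y|r w wm]; rewrite ?mulrDl ?mulrDr //.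
have wE := Zmu_mu wm.
by rewrite mulrA -tensor_comm // -!mulrA -!tensor_jM // mulrC.
Qed.

(* Elements of T are compared with their coordinates over Z[mu_m] for all large m | e at
   once: these germs form a quotient of the functions of m and of the basis index. *)
Lemma tensor_coordinates : exists (w : nat -> algC) (P : nat -> algC -> {poly int}),
  [/\ forall m, (0 < m)%N -> w m ^+ m = 1 /\ P m 1 = 1,
      forall m z, (0 < m)%N -> Zmu (nat_steinitz m) z -> (map_poly intr (P m z)).[w m] = z
    & forall l : seq (R * algC), (forall p, p \in l -> mu e p.2) ->
      forall d, (\sum_(p <- l) i1 p.1 * j p.2) *+ d = 0 ->
      exists n, steinitz_dvd n e /\ forall m, steinitz_dvd m e -> (n %| m)%N ->
        forall i, (\sum_(p <- l) p.1 *~ (P m p.2)`_i) *+ d = 0].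
Proof.
pose good n (wp : algC * (algC -> {poly int})) := (0 < n)%N ->
   [/\ wp.1 ^+ n = 1,
       forall z, Zmu (nat_steinitz n) z -> (map_poly intr (wp.2 z)).[wp.1] = z,
       forall x y, Zmu (nat_steinitz n) x -> Zmu (nat_steinitz n) y -> wp.2 (x + y) = wp.2 x + wp.2 y
     & wp.2 1 = 1].
have [n|WP WPP] := @choice _ _ good.
  have [n0|n0] := posnP n; first by exists (0, fun=> 0); rewrite /good n0.
  by have [w [P PP]] := cyclotomic_coordinates n0; exists (w, P).
exists (fun n => (WP n).1), (fun n => (WP n).2); split=> [m /WPP[]//|m z /WPP[_ + _ _]|l lm d]; first exact.
pose S (f : nat -> nat -> R) := exists n, steinitz_dvd n e /\
  forall m, steinitz_dvd m e -> (n %| m)%N -> forall i, f m i = 0.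
have S0 : S 0 by exists 1%N; split=> //; apply: steinitz_dvd1.
have SB f g : S f -> S g -> S (f - g).
  move=> [n [ne fn]] [n' [ne' gn]]; exists (lcmn n n'); split.
    exact: steinitz_dvd_lcm.
  move=> m me; rewrite dvdn_lcm => /andP[nm nm'] i.
  by rewrite -[LHS]/(f m i - g m i) fn // gn // subrr.
have [Q [q [qD qS]]] := zmod_quotient S0 SB.
pose F r z : nat -> nat -> R := fun m i => r *~ ((WP m).2 z)`_i.
have qeq f g : S (f - g) -> q f = q g.
  by move/qS; rewrite (additiveB qD) => /eqP; rewrite subr_eq0 => /eqP.
have [||f [fD fF]] := @tensor_map Q (fun r z => q (F r z)).
- move=> r r' z zE; rewrite -qD; congr q; apply: funext => m; apply: funext => i.
  by rewrite -[RHS]/(F r z m i + F r' z m i) /F mulrzDl.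
(* Coordinates at level m add up only once z and z' both lie in Z[mu_m], which is why germs in m are
   needed. *)
- move=> r z z' /Zmu_level[n [ne zn]] /Zmu_level[n' [ne' zn']]; rewrite -qD.
  apply: qeq; exists (lcmn n n'); split; first exact: steinitz_dvd_lcm.
  move=> m me; rewrite dvdn_lcm => /andP[nm nm'] i; have m0 := steinitz_dvd_gt0 me.
  have [_ _ PD _] := WPP m m0.
  rewrite -[LHS]/(F r (z + z') m i - (F r z m i + F r z' m i)) /F.
  have [zm zm'] := (Zmu_nat_steinitz_dvd m0 nm zn, Zmu_nat_steinitz_dvd m0 nm' zn').
  by rewrite PD ?coefD ?mulrzDr ?subrr.
have fl : f ((\sum_(p <- l) i1 p.1 * j p.2) *+ d) =
    q (fun m i => (\sum_(p <- l) p.1 *~ ((WP m).2 p.2)`_i) *+ d).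
  rewrite (additiveMn fD) (additive_sum fD).
  transitivity ((q (fun m i => \sum_(p <- l) p.1 *~ ((WP m).2 p.2)`_i)) *+ d).
    congr (_ *+ _); elim: l lm => [|p l IH] lm.
      rewrite big_nil -(additive0 qD); congr q; apply: funext => m; apply: funext => i.
      by rewrite big_nil.
    rewrite big_cons IH => [|p' p'l]; last by apply: lm; rewrite inE p'l orbT.
    rewrite fF; last by apply: Zmu_mu; apply: lm; rewrite inE eqxx.
    rewrite -qD; congr q; apply: funext => m; apply: funext => i.
    by rewrite big_cons.
  rewrite -(additiveMn qD); congr q; apply: funext => m; apply: funext => i.
  elim: d => [|d IH]; first by rewrite !mulr0n.
  by rewrite !mulrS -IH.
by move=> x0; move: fl; rewrite x0 (additive0 fD) => /esym/qS.
Qed.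

(** The constant coordinate of r (x) 1 is r, because [P m 1 = 1]. *)
Lemma tensor_i1_inj r : i1 r = 0 -> r = 0.
Proof.
move=> r0; have [w [P [P1 _ Pl]]] := tensor_coordinates.
have [||n [ne nP]] := Pl [:: (r, 1)] _ 1%N.
- by move=> p; rewrite inE => /eqP->; apply: mu1.
- by rewrite big_seq1 r0 mul0r.
have := nP n ne (dvdnn n) 0%N; rewrite big_seq1 (P1 n _).2; last exact: steinitz_dvd_gt0 ne.
by rewrite coef1.
Qed.

Hypothesis Rtf : forall d : nat, steinitz_dvd d e -> injective (fun r : R => r *+ d).

(** Coordinates of x at a deep enough level are killed by d, hence vanish in R, and x is recovered
    from them. *)
Lemma tensor_torsion_free d (x : T) : steinitz_dvd d e -> x *+ d = 0 -> x = 0.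
Proof.
move=> de; have [l [lm ->]] := tensor_span x => xd.
have [w [P [P1 Pev Pl]]] := tensor_coordinates.
have [n [ne nP]] := Pl l lm d xd.
have [|N [Ne NP]] := @mu_common_order e [seq p.2 | p <- l].
  by move=> z /mapP[p /lm pm ->].
(* n makes the coordinates at level m be annihilated by d; N puts the roots of unity occurring in x
   into mu_m, so that they are values of their coordinate polynomials. *)
have me := steinitz_dvd_lcm ne Ne; set m := lcmn n N in me.
have m0 := steinitz_dvd_gt0 me.
have wm i : Zmu e (w m ^+ i) by apply: Zmu_mu; apply: muX; exists m; rewrite (P1 m m0).1.
pose B := \max_(p <- l) size (P m p.2).
transitivity (\sum_(i < B) i1 (\sum_(p <- l) p.1 *~ (P m p.2)`_i) * j (w m ^+ i)); last first.
  rewrite big1 // => i _; suff -> : \sum_(p <- l) p.1 *~ (P m p.2)`_i = 0.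
    by rewrite (additive0 tensor_i1D) mul0r.
  by apply: (Rtf de); rewrite mul0rn; apply: nP; rewrite ?dvdn_lcml.
under [RHS]eq_bigr do rewrite (additive_sum tensor_i1D) mulr_suml.
rewrite exchange_big /= !big_seq; apply: eq_bigr => p pl.
have pm : Zmu (nat_steinitz m) p.2.
  apply: Zmu_mu; apply/(mu_nat_steinitz _ m0); apply: (expr_dvd (n := N)); last exact: dvdn_lcmr.
  by apply: NP; apply/mapP; exists p.
rewrite -{1}(Pev m p.2 m0 pm) (horner_coef_wide (n := B)); last first.
  by rewrite size_map_inj_poly ?rmorph0 //; [exact: leq_bigmax_seq|exact: intr_inj].
rewrite tensor_j_sum => [|i _ _]; last by rewrite coef_map mulrzl; apply: Zmu_Mz.
rewrite mulr_sumr; apply: eq_bigr => i _.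
by rewrite coef_map mulrzl tensor_jMz // (additiveMz tensor_i1D) mulrzAl mulrzAr.
Qed.

(** The substitute for invertibility of z - w: u = z / w fixes x, and its geometric sum over one
    period, which is 0, acts on x as d. *)
Lemma tensor_root_separation z w x : mu e z -> mu e w -> z != w ->
  j z * x = j w * x -> x = 0.
Proof.
move=> zm wm zw zwx; pose u := z / w; have um : mu e u by apply: muM => //; apply: muV.
have u1 : u != 1.
  by apply: contraNneq zw => u1; rewrite -(divfK (mu_neq0 wm) z) -/u u1 mul1r.
have uE := Zmu_mu um.
have ux : j u * x = x.
  have wVE : Zmu e w^-1 by apply: Zmu_mu; apply: muV.
  rewrite /u mulrC tensor_jM //; last exact: Zmu_mu.
  by rewrite -mulrA zwx mulrA -tensor_jM ?mulVf ?(mu_neq0 wm) ?tensor_j1 ?mul1r //; apply: Zmu_mu.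
have uX n : j (u ^+ n) * x = x.
  elim: n => [|n IH]; first by rewrite tensor_j1 mul1r.
  by rewrite exprSr tensor_jM -?mulrA ?ux //; apply: Zmu_mu; apply: muX.
case: um => d [de ud]; apply: (tensor_torsion_free de).
have d0 : \sum_(i < d) u ^+ i = 0.
  apply/eqP; have /eqP := subrX1 u d; rewrite ud subrr eq_sym mulf_eq0 subr_eq0.
  by rewrite (negPf u1).
transitivity (j (\sum_(i < d) u ^+ i) * x); last by rewrite d0 tensor_j0 mul0r.
rewrite tensor_j_sum => [|i _ _]; last by apply: Zmu_mu; apply: muX; exists d.
by rewrite mulr_suml; under eq_bigr do rewrite uX; rewrite sumr_const card_ord.
Qed.

End Tensor.

(** * Direct decompositions *)

Lemma sum_superset (I : eqType) (V : zmodType) (s u : seq I) (f : I -> V) :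
  uniq s -> uniq u -> {subset s <= u} -> (forall i, i \notin s -> f i = 0) ->
  \sum_(i <- u) f i = \sum_(i <- s) f i.
Proof.
move=> us uu su f0; rewrite (bigID (mem s)) /= addrC big1 ?add0r => [|i /f0//].
rewrite -big_filter; apply: perm_big; apply: uniq_perm; rewrite ?filter_uniq // => i.
by rewrite mem_filter; case: (boolP (i \in s)) => //= /su.
Qed.

Section Decomposition.
Variables (I : eqType) (V : zmodType) (B : I -> V -> Prop).

Definition direct_decomposition : Prop :=
  [/\ forall i, B i 0,
      forall i x y, B i x -> B i y -> B i (x - y),
      forall x, exists (s : seq I) (y : I -> V),
        [/\ uniq s, forall i, i \in s -> B i (y i) & x = \sum_(i <- s) y i]
    & forall (s : seq I) (y : I -> V), uniq s -> (forall i, i \in s -> B i (y i)) ->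
        \sum_(i <- s) y i = 0 -> forall i, i \in s -> y i = 0].

Hypothesis BP : direct_decomposition.

Lemma decomposition_add i x y : B i x -> B i y -> B i (x + y).
Proof.
case: BP => B0 BB _ _ Bx By; rewrite -[y]opprK; apply: (BB) => //.
by rewrite -sub0r; apply: BB.
Qed.

Lemma decomposition_proj : exists (supp : V -> seq I) (pr : V -> I -> V),
  forall x, [/\ uniq (supp x), forall i, B i (pr x i),
    forall i, i \notin supp x -> pr x i = 0, x = \sum_(i <- supp x) pr x i
  & forall s y, uniq s -> (forall i, i \in s -> B i (y i)) -> x = \sum_(i <- s) y i ->
      forall i, pr x i = if i \in s then y i else 0].
Proof.
case: BP => B0 BB Bspan Bindep.
pose good x (sp : seq I * (I -> V)) := [/\ uniq sp.1, forall i, B i (sp.2 i),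
    forall i, i \notin sp.1 -> sp.2 i = 0 & x = \sum_(i <- sp.1) sp.2 i].
have [x|sp spP] := @choice _ _ good.
  have [s [y [us sB xE]]] := Bspan x.
  exists (s, fun i => if i \in s then y i else 0); split=> //= [i|i|].
  - by case: ifP => [/sB|].
  - by move/negPf->.
  - by rewrite xE !big_seq; apply: eq_bigr => i ->.
exists (fun x => (sp x).1), (fun x => (sp x).2) => x.
have [us sB s0 xE] := spP x; split=> // s y us' yB xE' i.
pose y' i := if i \in s then y i else 0; pose u := undup ((sp x).1 ++ s).
have uu : uniq u by apply: undup_uniq.
have y'B k : B k (y' k) by rewrite /y'; case: ifP => [/yB|].
have z0 k : k \in u -> (sp x).2 k - y' k = 0.
  move: k; apply: Bindep => // [k _|]; first exact: BB.
  rewrite sumrB (sum_superset us) // => [|k kx]; last by rewrite mem_undup mem_cat kx.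
  rewrite (sum_superset (u := u) us') // => [|k ks|k /negPf ks].
  - rewrite -xE {1}xE' [X in _ - X]big_seq [X in X - _]big_seq.
    by rewrite (eq_bigr y') ?subrr // => k ks; rewrite /y' ks.
  - by rewrite mem_undup mem_cat ks orbT.
  - by rewrite /y' ks.
have [/z0/subr0_eq//|] := boolP (i \in u).
by rewrite mem_undup mem_cat negb_or => /andP[/s0-> /negPf->].
Qed.

(** The i-th component of x is sent through [F i]; additivity is checked on a common support of x, y
    and x + y. *)
Lemma decomposition_extend (W : zmodType) (F : I -> V -> W) :
  (forall i x y, F i (x + y) = F i x + F i y) ->
  exists g : V -> W, (forall x y, g (x + y) = g x + g y) /\
    forall i x, B i x -> g x = F i x.
Proof.
move=> FD; have [supp [pr prP]] := decomposition_proj.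
have F0 i : F i 0 = 0 by apply: (additive0 (FD i)).
exists (fun x => \sum_(i <- supp x) F i (pr x i)); split=> [x y|i x Bx].
  have [[ux xB x0 xE _] [uy yB y0 yE _]] := (prP x, prP y).
  have [uxy xyB xy0 xyE xyU] := prP (x + y).
  pose u := undup (supp x ++ supp y ++ supp (x + y)).
  have uu : uniq u by apply: undup_uniq.
  have [su1 su2 su3] : [/\ {subset supp x <= u}, {subset supp y <= u} & {subset supp (x + y) <= u}].
    by split=> k ks; rewrite mem_undup !mem_cat ks ?orbT.
  rewrite -(sum_superset ux uu su1) => [|k /x0->//].
  rewrite -(sum_superset uy uu su2) => [|k /y0->//].
  rewrite -(sum_superset uxy uu su3) => [|k /xy0->//].
  rewrite -big_split /= !big_seq; apply: eq_bigr => k ku.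
  rewrite (xyU u (fun k => pr x k + pr y k)) ?ku ?FD // => [l _|].
    exact: decomposition_add.
  by rewrite big_split /= (sum_superset (u := u) ux) // (sum_superset (u := u) uy) // -xE -yE.
have [ux xB x0 xE xU] := prP x.
have xi k : pr x k = if k == i then x else 0.
  rewrite (xU [:: i] (fun=> x)) ?big_seq1 ?inE // => l; by rewrite inE => /eqP->.
rewrite -(sum_superset (s := supp x) (u := undup (i :: supp x))) ?undup_uniq //.
- rewrite (sum_superset (s := [:: i])) ?undup_uniq //.
  + by rewrite big_seq1 xi eqxx.
  + by move=> k; rewrite mem_undup !inE => ->.
  + by move=> k; rewrite inE xi => /negPf->.
- by move=> k ks; rewrite mem_undup inE ks orbT.
- by move=> k /x0->.
Qed.

End Decomposition.

(** Gradings and [mu_diag] ask for distinct labels, whereas constructions yield lists with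
    repetitions; summands with equal labels are merged. *)
Lemma decomposition_group (I : eqType) (V : zmodType) (B : I -> V -> Prop) (l : seq (I * V)) :
  (forall i, B i 0) -> (forall i x y, B i x -> B i y -> B i (x + y)) ->
  (forall p, p \in l -> B p.1 p.2) ->
  exists (s : seq I) (y : I -> V),
    [/\ uniq s, {subset s <= [seq p.1 | p <- l]}, forall i, i \in s -> B i (y i)
    & \sum_(p <- l) p.2 = \sum_(i <- s) y i].
Proof.
move=> B0 BD lB; exists (undup [seq p.1 | p <- l]), (fun i => \sum_(p <- l | p.1 == i) p.2).
split; first exact: undup_uniq.
  by move=> i; rewrite mem_undup.
  move=> i _; rewrite big_seq_cond; apply: (big_ind (B i)) => //; first exact: BD.
  by move=> p /andP[/lB pB /eqP <-].
rewrite (exchange_big_dep xpredT) //= !big_seq; apply: eq_bigr => p pl.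
rewrite big_mkcond (sum_superset (s := [:: p.1])) ?undup_uniq ?big_seq1 ?eqxx // => i.
  by rewrite inE => /eqP->; rewrite mem_undup; apply/mapP; exists p.
by rewrite inE eq_sym => /negPf->.
Qed.

(** * Galois descent and eigenspaces *)

Section GaloisDescent.
Variables (e : steinitz) (R T : pzRingType) (i1 : R -> T) (j : algC -> T).
Hypothesis HT : is_tensor e i1 j.

(** [Xe] quantifies over maps satisfying [is_tau]; one is built here as the identity of R tensored
    with the Galois action on Z[mu_e]. *)
Lemma tensor_tau a : Zhat_unit e a -> exists t, is_tau e i1 j a t.
Proof.
move=> a_unit; have [u [uE uD uM uX]] := Zhat_unit_galois a_unit.
have [||t [tD tE]] := @tensor_map _ _ _ _ _ HT T (fun r z => i1 r * j (u z)).
- by move=> r r' z zE; rewrite (tensor_i1D HT) mulrDl.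
- by move=> r z z' zE z'E; rewrite uD // (tensor_jD HT) ?mulrDr //; apply: uE.
have u1 : u 1 = 1 by rewrite (uX _ _ (steinitz_dvd1 e)) ?expr1n.
have ti r : t (i1 r) = i1 r.
  by rewrite -[X in t X]mulr1 -(tensor_j1 HT) tE ?u1 ?(tensor_j1 HT) ?mulr1 //; apply: Zmu1.
exists t; split=> //; split; last split=> // z d de zd.
- move=> x y; move: x; apply: (tensor_ext HT) => [x x'|x x'|r z zm].
  + by rewrite mulrDl tD.
  + by rewrite tD mulrDl.
  move: y; apply: (tensor_ext HT) => [y y'|y y'|r' z' z'm]; rewrite ?mulrDr ?tD ?mulrDr //.
  have [zE z'E] := (Zmu_mu zm, Zmu_mu z'm).
  have h c c' (x x' : R) : Zmu e c -> i1 x * j c * (i1 x' * j c') = i1 (x * x') * (j c * j c').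
    by move=> cE; rewrite (tensor_i1M HT) mulrA -(mulrA _ (j c)) -(tensor_comm HT) // !mulrA.
  rewrite !tE // !h //; last exact: uE.
  rewrite -(tensor_jM HT) // tE; last exact: ZmuM.
  by rewrite uM // (tensor_jM HT) //; apply: uE.
- have zE : Zmu e z by apply: Zmu_mu; exists d.
  by rewrite -[X in t X]mul1r -(tensor_i1_1 HT) tE // (tensor_i1_1 HT) mul1r (uX _ _ de zd).
Qed.

Lemma tau_mul a t z d x : is_tau e i1 j a t -> steinitz_dvd d e -> z ^+ d = 1 ->
  t (j z * x) = j (z ^+ a d) * t x.
Proof. by move=> [_ [tM [_ tj]]] de zd; rewrite tM (tj _ _ de zd). Qed.

Hypothesis Rtf : forall d : nat, steinitz_dvd d e -> injective (fun r : R => r *+ d).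

(* n x is the sum over a of D_a tau_a(x), which lies in n i1(R) by the choice of the D_a. *)
Lemma tau_descent x :
  (forall a t, Zhat_unit e a -> is_tau e i1 j a t -> t x = x) -> exists r, x = i1 r.
Proof.
move=> xtau; have [l [lm xE]] := tensor_span HT x.
have [|n [ne nP]] := @mu_common_order e [seq p.2 | p <- l].
  by move=> z /mapP[p /lm pm ->].
have n0 := steinitz_dvd_gt0 ne; have [w w_prim] := C_prim_root_exists n0.
have wm i : mu e (w ^+ i) by apply: muX; exists n; rewrite (prim_expr_order w_prim).
have DE a : Zmu e (cyclo_dual n w a).
  apply: Zmu_prod => p _ _; apply: ZmuB; first exact: Zmu1.
  by apply: Zmu_mu; rewrite -exprM; apply: wm.
have zX p a : p \in l -> Zmu e (p.2 ^+ a) by move=> /lm pm; apply: Zmu_mu; apply: muX.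
(* As x is fixed, its a-th conjugate is x again; it is computed termwise after lifting a to a unit
   of Zhat / e Zhat. *)
have xa (a : 'I_n) : coprime a n -> x = \sum_(p <- l) i1 p.1 * j (p.2 ^+ a).
  move=> an; have [b [b_unit ba]] := Zhat_unit_lift e n0 an.
  have [t t_tau] := tensor_tau b_unit; have [tD [tM [ti tj]]] := t_tau.
  rewrite -{1}(xtau b t b_unit t_tau) {1}xE (additive_sum tD) !big_seq.
  apply: eq_bigr => p pl; have pn : p.2 ^+ n = 1 by apply: nP; apply/mapP; exists p.
  by rewrite tM ti (tj _ _ ne pn) (expr_eq_mod pn ba).
have [|m mP] := @choice (R * algC) int (fun p m => p \in l ->
    \sum_(a < n | coprime a n) cyclo_dual n w a * p.2 ^+ a = n%:R *~ m).
  move=> p; have [pl|pl] := boolP (p \in l); last by exists 0.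
  have pn : p.2 ^+ n = 1 by apply: nP; apply/mapP; exists p.
  by have [m mE] := cyclo_dual_int n0 w_prim pn; exists m.
(* In n x = Tr(c) x, the a-th term is rewritten with the a-th conjugate of x. Exchanging sums leaves
   traces of c times the roots in l, equal to n times [m p]. *)
exists (\sum_(p <- l) p.1 *~ m p); apply/eqP; rewrite -subr_eq0; apply/eqP.
apply: (tensor_torsion_free HT Rtf ne); rewrite mulrnBl; apply/eqP; rewrite subr_eq0; apply/eqP.
transitivity (j (\sum_(a < n | coprime a n) cyclo_dual n w a) * x).
  rewrite (cyclo_dual_trace n0 w_prim) (tensor_jMn HT) ?(tensor_j1 HT); last exact: Zmu1.
  by rewrite mulr_natl.
rewrite (tensor_j_sum HT) // mulr_suml.
under eq_bigr => a an do rewrite {1}(xa a an) mulr_sumr.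
rewrite exchange_big (additive_sum (tensor_i1D HT)) -sumrMnl !big_seq.
apply: eq_bigr => p pl.
transitivity (i1 p.1 * j (\sum_(a < n | coprime a n) cyclo_dual n w a * p.2 ^+ a)).
  rewrite (tensor_j_sum HT) => [|a _ _]; last by apply: ZmuM; [apply: DE|apply: zX].
  rewrite mulr_sumr; apply: eq_bigr => a an.
  by rewrite mulrA -(tensor_comm HT) // -mulrA -(tensor_jM HT) //; apply: zX.
rewrite mP // (tensor_jMz HT) ?(tensor_jMn HT) ?(tensor_j1 HT); [|exact: Zmu1|exact: Zmu_nat].
by rewrite (additiveMz (tensor_i1D HT)) mulrzAr mulr_natr !pmulrn mulrzAC.
Qed.

End GaloisDescent.

(** * Eigenspaces of automorphisms of R' *)

Section EigenDecomposition.
Variables (e : steinitz) (k : comPzRingType) (R : pzRingType) (phi : k -> R).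
Hypothesis Halg : is_kalg phi.
Hypothesis Rtf : forall d : nat, steinitz_dvd d e -> injective (fun r : R => r *+ d).
Variables (T : pzRingType) (i1 : R -> T) (j : algC -> T).
Hypothesis HT : is_tensor e i1 j.

Lemma Aut_add s x y : isAut e phi i1 j s -> s (x + y) = s x + s y.
Proof. by case=> _ [+ _]; apply. Qed.

Lemma Aut_scale s z x : isAut e phi i1 j s -> Zmu e z -> s (j z * x) = j z * s x.
Proof.
move=> [_ [_ [_ [_ sE]]]] zE; have := sE 1 z x zE.
by case: Halg => _ [_ [-> _]]; rewrite (tensor_i1_1 HT) !mul1r.
Qed.

Lemma eigenB s z x y : isAut e phi i1 j s ->
  eigen j s z x -> eigen j s z y -> eigen j s z (x - y).
Proof.
move=> sA; rewrite /eigen (additiveB (fun x y => @Aut_add s x y sA)) => -> ->.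
by rewrite mulrBr.
Qed.

Lemma eigen0 s z : isAut e phi i1 j s -> eigen j s z 0.
Proof.
by move=> sA; rewrite /eigen (additive0 (fun x y => @Aut_add s x y sA)) mulr0.
Qed.

Lemma eigenD s z x y : isAut e phi i1 j s ->
  eigen j s z x -> eigen j s z y -> eigen j s z (x + y).
Proof. by move=> sA; rewrite /eigen (Aut_add _ _ sA) => -> ->; rewrite mulrDr. Qed.

Lemma eigen_scale s z c x : isAut e phi i1 j s -> Zmu e c -> Zmu e z ->
  eigen j s z x -> eigen j s z (j c * x).
Proof.
move=> sA cE zE; rewrite /eigen (Aut_scale _ sA cE) => ->.
by rewrite !mulrA -!(tensor_jM HT) // mulrC.
Qed.

(** Dedekind's argument: pick s in Y separating g from the head w, apply it to the relation and
    subtract [v w s] times the relation. The shorter relation has terms (v g s - v w s) y_g, zero by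
    induction, and [tensor_root_separation] gives y_g = 0. *)
Lemma common_eigen_independent (I : eqType) (Y : (T -> T) -> Prop) (v : I -> (T -> T) -> algC)
    (l : seq I) (y : I -> T) :
  (forall s, Y s -> isAut e phi i1 j s) ->
  (forall g s, g \in l -> Y s -> mu e (v g s)) ->
  (forall g h, g \in l -> h \in l -> g != h -> exists2 s, Y s & v g s != v h s) ->
  uniq l -> (forall g s, g \in l -> Y s -> eigen j s (v g s) (y g)) ->
  \sum_(g <- l) y g = 0 -> forall g, g \in l -> y g = 0.
Proof.
move=> YA; elim: l y => [//|w l IH] y vm vsep /= /andP[wl ul] yP sum0.
have lw g : g \in l -> g \in w :: l by rewrite inE orbC => ->.
have ww : w \in w :: l by rewrite inE eqxx.
have yl g : g \in l -> y g = 0.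
  move=> gl; have gw : g != w by apply: contraNneq wl => <-.
  have [s Ys vs] := vsep g w (lw _ gl) ww gw; have sA := YA s Ys.
  have sD x x' := @Aut_add s x x' sA.
  apply: (tensor_root_separation HT Rtf (vm _ _ (lw _ gl) Ys) (vm _ _ ww Ys) vs).
  apply/eqP; rewrite -subr_eq0; apply/eqP; move: g gl {gw vs}.
  apply: (IH (fun g => j (v g s) * y g - j (v w s) * y g)) => //.
  - by move=> g s' /lw; apply: vm.
  - by move=> g h /lw gl /lw hl; apply: vsep.
  - move=> g s' gl Ys'; have vE h s'' : h \in w :: l -> Y s'' -> Zmu e (v h s'').
      by move=> hl Ys''; apply: Zmu_mu; apply: vm.
    have s'A := YA s' Ys'.
    have yg := yP g s' (lw _ gl) Ys'.
    by apply: eigenB => //; apply: eigen_scale => //; apply: vE => //; apply: lw.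
  rewrite sumrB -mulr_sumr.
  have := congr1 s sum0; rewrite (additive_sum sD) (additive0 sD) big_cons yP //.
  move: sum0; rewrite big_cons => /eqP; rewrite addr_eq0 => /eqP->.
  rewrite mulrN => /eqP; rewrite addrC subr_eq0 => /eqP <-.
  apply/eqP; rewrite subr_eq0; apply/eqP; rewrite !big_seq; apply: eq_bigr => g gl.
  by rewrite (yP g s (lw _ gl) Ys).
move=> g; rewrite inE => /orP[/eqP->|/yl//].
by move: sum0; rewrite big_cons big_seq big1 ?addr0 // => h /yl.
Qed.

Lemma eigen_independent s : isAut e phi i1 j s ->
  forall (l : seq algC) (y : algC -> T), uniq l ->
    (forall z, z \in l -> mu e z /\ eigen j s z (y z)) ->
    \sum_(z <- l) y z = 0 -> forall z, z \in l -> y z = 0.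
Proof.
move=> sA l y ul yP.
apply: (@common_eigen_independent _ (eq s) (fun z _ => z) l y) => //.
- by move=> s' <-.
- by move=> z s' /yP[].
- by move=> z w _ _ zw; exists s.
- by move=> z s' /yP[_ yz] <-.
Qed.

(** The index type is all of [algC], so labels outside mu_e carry the zero subspace. *)
Lemma eigen_decomposition s : isAut e phi i1 j s -> mu_diag e j s ->
  direct_decomposition (fun z x => x = 0 \/ mu e z /\ eigen j s z x).
Proof.
move=> sA [span _]; split=> [z|z x y [->|[zm xz]] [->|[zm' yz]]|x|l y ul yP sum0 z zl].
- by left.
- by left; rewrite subrr.
- by right; split=> //; apply: eigenB => //; apply: eigen0.
- by right; rewrite subr0.
- by right; split=> //; apply: eigenB.
- by have [l [y [ul [yP xE]]]] := span x; exists l, y; split=> // z /yP; right.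
have [//|y0] := eqVneq (y z) 0; have [ymz|[zm _]] := yP z zl; first by rewrite ymz eqxx in y0.
pose l' := [seq z <- l | `[< mu e z >]].
apply: (@eigen_independent s sA l' y); rewrite ?filter_uniq ?mem_filter ?zl ?andbT //.
- move=> z'; rewrite mem_filter => /andP[/asboolP z'm /yP[->|//]].
  by split=> //; apply: eigen0.
- transitivity (\sum_(z <- l) y z) => //.
  rewrite [RHS](bigID (fun z => `[< mu e z >])) /= big_filter [X in _ = _ + X]big_seq_cond.
  rewrite [X in _ = _ + X]big1 ?addr0 // => z' /andP[/yP[//|[z'm _]] /asboolP].
  by [].
- exact/asboolP.
Qed.

(** The condition in [Xe] ranges over maps that realize s^a; it can be exploited only when one
    exists. *)
Lemma pow_exists s a : isAut e phi i1 j s -> mu_diag e j s -> Zhat_unit e a ->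
  exists g, is_pow e j s a g.
Proof.
move=> sA sd a_unit; have [z|o oP] := @choice algC nat (fun z d => mu e z -> steinitz_dvd d e /\ z ^+ d = 1).
  by have [[d ?]|nz] := pselect (mu e z); [exists d|exists 0%N].
have [|g [gD gE]] := decomposition_extend (eigen_decomposition sA sd) (W := T)
    (F := fun z x => j (z ^+ a (o z)) * x).
  by move=> z x y; rewrite mulrDr.
exists g; split=> // z d de zd x xz.
have zm : mu e z by exists d.
have [oe zo] := oP z zm; rewrite (gE z); last by right.
by rewrite (Zhat_unit_pow a_unit oe de zo zd).
Qed.

Let X := Xe e phi i1 j.

(** Let v_z' be the components of tau_a y. Comparing tau_a (s y) with s^a (tau_a y) gives (z^a -
    z'^a) v_z' = 0, and z^a differs from z'^a when z' differs from z. *)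
Lemma Xe_eigen_tau s a t z y : X s -> Zhat_unit e a -> is_tau e i1 j a t ->
  mu e z -> eigen j s z y -> eigen j s z (t y).
Proof.
move=> [sA [sd sX]] a_unit t_tau zm yz.
have [g g_pow] := pow_exists sA sd a_unit; have [gD gE] := g_pow.
have := sX a a_unit t t_tau g g_pow y; rewrite yz.
have [l [v [ul [vP tyE]]]] := sd.1 (t y).
have [z' |d [de dP]] := @mu_common_order e (z :: l).
  by rewrite inE => /orP[/eqP->|/vP[]].
have zd : z ^+ d = 1 by apply: dP; rewrite inE eqxx.
have ld z' : z' \in l -> z' ^+ d = 1 by move=> z'l; apply: dP; rewrite inE z'l orbT.
rewrite (tau_mul _ t_tau de zd) {1 2}tyE (additive_sum gD) mulr_sumr => sum_eq.
have v0 z' : z' \in l -> z' != z -> v z' = 0.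
  move=> z'l z'z; have [z'm vz'] := vP z' z'l.
  apply: (tensor_root_separation HT Rtf (z := z ^+ a d) (w := z' ^+ a d)); rewrite ?muX //.
  - by apply: muX.
  - by apply: muX.
  - apply: contra z'z => /eqP/(Zhat_unit_pow_inj a_unit de zd (ld _ z'l)) ->.
    by [].
  apply/eqP; rewrite -subr_eq0; apply/eqP; move: z' z'l {z'z z'm vz'}.
  apply: (sd.2 l (fun z' => j (z ^+ a d) * v z' - j (z' ^+ a d) * v z')) => // [z' z'l|].
    have [z'm vz'] := vP z' z'l; split=> //.
    have zaE u : mu e u -> Zmu e (u ^+ a d) by move=> um; apply: Zmu_mu; apply: muX.
    have z'E := Zmu_mu z'm.
    by apply: eigenB => //; apply: eigen_scale => //; apply: zaE.
  rewrite sumrB sum_eq; apply/eqP; rewrite subr_eq0; apply/eqP.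
  rewrite !big_seq; apply: eq_bigr => z' z'l; have [z'm vz'] := vP z' z'l.
  by rewrite (gE z' d de (ld _ z'l) _ vz').
rewrite tyE big_seq; apply: (big_ind (eigen j s z)) => [|x x'|z' z'l].
- exact: eigen0.
- exact: eigenD.
have [<-|z'z] := eqVneq z' z; first by case: (vP z' z'l).
by rewrite v0 //; apply: eigen0.
Qed.

(** tau_a fixes [i1 r] and preserves the eigenspaces, hence fixes each component, and descent
    applies. The last clause lets decompositions for commuting automorphisms be iterated: s'
    preserves the eigenspaces of s, so eigenvectors of s' have eigenvector components. *)
Lemma Xe_components s r : X s -> exists (l : seq algC) (y : algC -> R),
  [/\ uniq l, forall z, z \in l -> mu e z /\ eigen j s z (i1 (y z)), r = \sum_(z <- l) y z
    & forall s' w, isAut e phi i1 j s' -> (forall x, s (s' x) = s' (s x)) -> mu e w ->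
        eigen j s' w (i1 r) -> forall z, z \in l -> eigen j s' w (i1 (y z))].
Proof.
move=> sX; have [sA [sd _]] := sX.
have [l [v [ul [vP rE]]]] := sd.1 (i1 r).
have vi z : z \in l -> exists x, v z = i1 x.
  move=> zl; apply: (tau_descent HT Rtf) => a t a_unit t_tau.
  have [tD [_ [ti _]]] := t_tau.
  apply/eqP; rewrite -subr_eq0; apply/eqP; move: z zl.
  apply: (sd.2 l (fun z => t (v z) - v z)) => // [z zl|].
    have [zm vz] := vP z zl; split=> //; apply: eigenB => //.
    exact: (Xe_eigen_tau sX a_unit t_tau).
  by rewrite sumrB -(additive_sum tD) -rE ti subrr.
have [z|y yP] := @choice algC R (fun z x => z \in l -> v z = i1 x).
  by have [/vi[x xE]|_] := boolP (z \in l); [exists x|exists 0].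
exists l, y; split=> //.
- by move=> z zl; rewrite -yP //; apply: vP.
- apply/eqP; rewrite -subr_eq0; apply/eqP; apply: (tensor_i1_inj HT).
  rewrite (additiveB (tensor_i1D HT)) rE (additive_sum (tensor_i1D HT)).
  apply/eqP; rewrite subr_eq0; apply/eqP; rewrite !big_seq.
  by apply: eq_bigr => z /yP.
move=> s' w s'A ss' wm rw z zl; rewrite /eigen -yP //.
have wE := Zmu_mu wm.
apply/eqP; rewrite -subr_eq0; apply/eqP; move: z zl.
apply: (sd.2 l (fun z => s' (v z) - j w * v z)) => // [z zl|].
  have [zm vz] := vP z zl; split=> //; have zE := Zmu_mu zm; apply: eigenB => //.
    by rewrite /eigen ss' vz (Aut_scale _ s'A).
  exact: eigen_scale.
by rewrite sumrB -(additive_sum (fun x y => @Aut_add s' x y s'A)) -mulr_sumr -rE rw subrr.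
Qed.

End EigenDecomposition.

(** * Automorphisms from characters of the grading group *)

(** Multiplicative groups of functions become additively written [zmodType]s. It yields mu_e, as
    functions on a point, and the group generated by the weights. *)
Lemma function_group (U : Type) (P : (U -> algC) -> Prop) :
  P (fun=> 1) -> (forall f g, P f -> P g -> P (fun u => f u * g u)) ->
  (forall f, P f -> P (fun u => (f u)^-1)) -> (forall f u, P f -> f u != 0) ->
  exists (G : zmodType) (v : G -> U -> algC),
    [/\ injective v, forall g, P (v g), forall f, P f -> exists g, v g = f
      & forall g h, v (g + h) = fun u => v g u * v h u].
Proof.
move=> P1 PM PV Pn0; pose car := {f | P f}.
pose C : choiceType := HB.pack car (gen_eqMixin car) (gen_choiceMixin car).
pose zero : C := exist P _ P1.
pose opp (f : C) : C := exist P _ (PV _ (svalP f)).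
pose add (f g : C) : C := exist P _ (PM _ _ (svalP f) (svalP g)).
have addA : associative add by move=> f g h; apply: eq_exist; apply: funext => u /=; rewrite mulrA.
have addC : commutative add by move=> f g; apply: eq_exist; apply: funext => u /=; rewrite mulrC.
have add0 : left_id zero add.
  by move=> [f Pf]; apply: eq_exist; apply: funext => u /=; rewrite mul1r.
have addN : left_inverse zero opp add.
  by move=> f; apply: eq_exist; apply: funext => u /=; rewrite mulVf // Pn0 //; apply: svalP.
pose Z : zmodType := HB.pack C (GRing.isZmodule.Build C addA addC add0 addN).
exists Z, (fun f : Z => sval (f : car)); split=> // [[f Pf] [g Pg]|f|f Pf].
- exact: eq_exist.
- exact: svalP.
- by exists (exist P f Pf).
Qed.

Section GradingTwist.
Variables (e : steinitz) (k : comPzRingType) (R : pzRingType) (phi : k -> R).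
Hypothesis Halg : is_kalg phi.
Hypothesis Rtf : forall d : nat, steinitz_dvd d e -> injective (fun r : R => r *+ d).
Variables (T : pzRingType) (i1 : R -> T) (j : algC -> T).
Hypothesis HT : is_tensor e i1 j.

Let i1D := tensor_i1D HT.
Let jM := tensor_jM HT.

(** Gradings are closed under sums and scalars by definition; negatives come from the scalar -1. *)
Lemma kalg_N1 : phi (- 1) = - 1.
Proof. by case: Halg => phiD [_ [phi1 _]]; rewrite (additiveN phiD) phi1. Qed.

Section OneGrading.
Variables (G : zmodType) (Rg : G -> R -> Prop).
Hypothesis HG : is_grading phi Rg.

Lemma grading_decomposition : direct_decomposition Rg.
Proof.
case: HG => sub [span [indep _]]; split=> // [g|g x y gx gy|x].
- by case: (sub g).
- have [_ [gD gZ]] := sub g; apply: gD => //.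
  by rewrite -mulN1r -kalg_N1; apply: gZ.
- by have [s [y [us [yP xE]]]] := span x; exists s, y.
Qed.

Lemma graded_tensor_ext (V : zmodType) (f h : T -> V) :
  (forall x y, f (x + y) = f x + f y) -> (forall x y, h (x + y) = h x + h y) ->
  (forall g r z, Rg g r -> mu e z -> f (i1 r * j z) = h (i1 r * j z)) -> f =1 h.
Proof.
move=> fD hD fh; apply: (tensor_ext HT) => // r z zm.
have [_ _ span _] := grading_decomposition.
have [s [y [_ yP ->]]] := span r.
rewrite (additive_sum i1D) mulr_suml (additive_sum fD) (additive_sum hD) !big_seq.
by apply: eq_bigr => g /yP gy; exact: (fh g _ _ gy zm).
Qed.

Definition character (c : G -> algC) : Prop :=
  (forall g h, c (g + h) = c g * c h) /\ forall g, mu e (c g).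

(** The automorphism attached to c, specified on homogeneous pure tensors only, which determine it
    by additivity. *)
Definition is_twist (c : G -> algC) (s : T -> T) : Prop :=
  (forall x y, s (x + y) = s x + s y) /\
  forall g r z, Rg g r -> mu e z -> s (i1 r * j z) = j (c g) * (i1 r * j z).

Lemma twist_exists (c : G -> algC) : (forall g, mu e (c g)) -> exists s, is_twist c s.
Proof.
move=> cm; have [|rho [rhoD rhoE]] := decomposition_extend grading_decomposition
    (W := T) (F := fun g r => j (c g) * i1 r).
  by move=> g r r'; rewrite i1D mulrDr.
have [||s [sD sE]] := tensor_map HT (beta := fun r z => rho r * j z).
- by move=> r r' z _; rewrite rhoD mulrDl.
- by move=> r z z' zE z'E; rewrite (tensor_jD HT) // mulrDr.
exists s; split=> // g r z gr zm.
by rewrite sE; [rewrite (rhoE _ _ gr) mulrA|apply: Zmu_mu].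
Qed.

Lemma twist_unique c s s' : is_twist c s -> is_twist c s' -> s =1 s'.
Proof.
move=> [sD sE] [s'D s'E]; apply: graded_tensor_ext => // g r z gr zm.
by rewrite (sE g) // (s'E g).
Qed.

Lemma twist_i1 c s g r : is_twist c s -> Rg g r -> s (i1 r) = j (c g) * i1 r.
Proof.
move=> [_ sE] gr; have := sE g r 1 gr (mu1 e).
by rewrite (tensor_j1 HT) mulr1.
Qed.

Lemma twist_scale c s z x : (forall g, mu e (c g)) -> is_twist c s -> Zmu e z ->
  s (j z * x) = j z * s x.
Proof.
move=> cm [sD sE] zE; move: z zE x; pose S z := Zmu e z /\ forall x, s (j z * x) = j z * s x.
suff h z : Zmu e z -> S z by move=> z /h[].
apply; rewrite /S.
- by split=> [|x]; [apply: Zmu1|rewrite (tensor_j1 HT) !mul1r].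
- move=> u w [uE uS] [wE wS]; split=> [|x]; first exact: ZmuB.
  by rewrite (tensor_jB HT) // !mulrBl (additiveB sD) uS wS.
- move=> u w [uE uS] [wE wS]; split=> [|x]; first exact: ZmuM.
  by rewrite jM // -!mulrA uS wS.
- move=> w wm; have wE := Zmu_mu wm; split=> // x.
  move: x; apply: graded_tensor_ext => [x y|x y|g r u gr um]; rewrite ?mulrDr ?sD ?mulrDr //.
  have uE := Zmu_mu um; have cE := Zmu_mu (cm g).
  rewrite mulrA -(tensor_comm HT) // -mulrA -jM // !(sE g) //; last exact: muM.
  by rewrite [w * u]mulrC jM // [in RHS](tensor_central HT (z := w)) // !mulrA.
Qed.

Lemma twist_comp c c' s s' : (forall g, mu e (c g)) -> (forall g, mu e (c' g)) ->
  is_twist c s -> is_twist c' s' -> is_twist (fun g => c g * c' g) (s \o s').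
Proof.
move=> cm c'm s_tw s'_tw; have [[sD sE] [s'D s'E]] := (s_tw, s'_tw).
split=> [x y|g r z gr zm] /=; first by rewrite s'D sD.
have [cE c'E] := (Zmu_mu (cm g), Zmu_mu (c'm g)).
rewrite (s'E g) // (twist_scale _ cm s_tw) // (sE g) //.
by rewrite mulrA -jM // [c' g * _]mulrC.
Qed.

Lemma twist_id c : (forall g, c g = 1) -> is_twist c id.
Proof. by move=> c1; split=> // g r z _ _; rewrite c1 (tensor_j1 HT) mul1r. Qed.

Lemma character0 c : character c -> c 0 = 1.
Proof.
move=> [cD cm]; apply: (mulfI (mu_neq0 (cm 0))).
by rewrite -cD addr0 mulr1.
Qed.

Lemma characterV c : character c -> character (fun g => (c g)^-1).
Proof.
move=> [cD cm]; split=> [g h|g]; first by rewrite cD invfM.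
exact: muV.
Qed.

(** For r in R_g and z in mu_e, tau_a takes c(g) (r (x) z) to c(g)^a (r (x) z^a), which is s^a
    applied to r (x) z^a. The inverse of s is the twist by the inverse character, and homogeneous
    pure tensors are eigenvectors that span. *)
Lemma twist_Xe c s : character c -> is_twist c s -> Xe e phi i1 j s.
Proof.
move=> c_char s_tw; have [[cD cm] [sD sE]] := (c_char, s_tw).
have cE g : Zmu e (c g) by apply: Zmu_mu.
have [sub [_ [_ [R1 Rmul]]]] := HG.
have sA : isAut e phi i1 j s.
  split; last split=> //; last split; last split.
  - have [cVD cVm] := characterV c_char; have [s' s'_tw] := twist_exists cVm.
    exists s' => x.
      apply: (twist_unique (twist_comp cVm cm s'_tw s_tw)); apply: twist_id => g.
      by rewrite mulVf // (mu_neq0 (cm g)).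
    apply: (twist_unique (twist_comp cm cVm s_tw s'_tw)); apply: twist_id => g.
    by rewrite mulfV // (mu_neq0 (cm g)).
  - move=> x y; move: x; apply: graded_tensor_ext => [x x'|x x'|g r z gr zm].
    + by rewrite mulrDl sD.
    + by rewrite sD mulrDl.
    move: y; apply: graded_tensor_ext => [y y'|y y'|g' r' z' gr' zm'].
    + by rewrite mulrDr sD.
    + by rewrite sD mulrDr.
    have [zE zE'] := (Zmu_mu zm, Zmu_mu zm').
    have swap : i1 r * j z * (i1 r' * j z') = i1 (r * r') * j (z * z').
      by rewrite (tensor_i1M HT) jM // mulrA -(mulrA _ (j z)) -(tensor_comm HT) // !mulrA.
    rewrite swap (sE _ _ _ (Rmul _ _ _ _ gr gr') (muM zm zm')).
    rewrite (sE _ _ _ gr zm) (sE _ _ _ gr' zm').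
    rewrite -swap cD jM // -!mulrA; congr (_ * _).
    rewrite (tensor_central HT (z := c g')) // [in RHS](tensor_central HT (z := c g')) //.
    by rewrite !mulrA.
  - by have := twist_i1 s_tw R1; rewrite (tensor_i1_1 HT) (character0 c_char) (tensor_j1 HT) mulr1.
  - move=> a z x zE; rewrite -!mulrA.
    rewrite -[in RHS](twist_scale _ cm s_tw) //; move: (j z * x).
    apply: graded_tensor_ext => [y y'|y y'|g r w gr wm]; rewrite ?mulrDr ?sD ?mulrDr //.
    have [_ [_ gZ]] := sub g.
    rewrite mulrA -(tensor_i1M HT) !(sE g) //; last exact: gZ.
    by rewrite (tensor_i1M HT) !mulrA (tensor_comm HT).
split=> //; split; last first.
  move=> a a_unit t t_tau u [uD uE]; have [tD [tM [ti tj]]] := t_tau.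
  apply: graded_tensor_ext => [x y|x y|g r z gr zm]; rewrite ?sD ?tD ?sD ?uD //.
  have [d [de cd]] := cm g; have [n [ne zn]] := zm.
  rewrite (sE g) // (tau_mul _ t_tau de cd) tM ti (tj _ _ ne zn).
  by rewrite (uE _ _ de cd _ (sE _ _ _ gr (muX (a n) zm))).
split=> [x|]; last exact: (eigen_independent Halg Rtf HT sA).
have [l [lP ->]] : exists l : seq (algC * T),
    (forall p, p \in l -> mu e p.1 /\ eigen j s p.1 p.2) /\ x = \sum_(p <- l) p.2.
  have [l [lm ->]] := tensor_span HT x.
  elim: l lm => [|p l IH] lm; first by exists [::]; rewrite !big_nil.
  have [|l' [l'P l'E]] := IH; first by move=> q ql; apply: lm; rewrite inE ql orbT.
  have pm : mu e p.2 by apply: lm; rewrite inE eqxx.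
  have [_ _ span _] := grading_decomposition; have [q [y [uq yP pE]]] := span p.1.
  exists ([seq (c g, i1 (y g) * j p.2) | g <- q] ++ l'); split.
    move=> p'; rewrite mem_cat => /orP[/mapP[g gq ->]|/l'P//] /=.
    by split=> //; rewrite /eigen (sE g) //; apply: yP.
  rewrite big_cons big_cat big_map /= l'E; congr (_ + _).
  by rewrite pE (additive_sum i1D) mulr_suml.
have [|||q [y [uq sq yP ->]]] := @decomposition_group _ _ (eigen j s) l.
- by move=> z; exact: eigen0 sA.
- by move=> z y y'; exact: eigenD sA.
- by move=> p /lP[].
exists q, y; split=> //; split=> // z zq; split; last exact: yP.
by have /mapP[p /lP[pm _] ->] := sq z zq.
Qed.

End OneGrading.
End GradingTwist.

(** * From a universal grading to X_e(R) *)

Section FromUniversal.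
Variables (e : steinitz) (k : comPzRingType) (R : pzRingType) (phi : k -> R).
Hypothesis Halg : is_kalg phi.
Hypothesis Rtf : forall d : nat, steinitz_dvd d e -> injective (fun r : R => r *+ d).
Variables (T : pzRingType) (i1 : R -> T) (j : algC -> T).
Hypothesis HT : is_tensor e i1 j.

Lemma Aut_kscale s c x : isAut e phi i1 j s -> s (i1 (phi c) * x) = i1 (phi c) * s x.
Proof.
move=> [_ [_ [_ [_ sE]]]]; have := sE c 1 x (@Zmu1 e).
by rewrite (tensor_j1 HT) mulr1.
Qed.

(** Common to both directions: Y is a single automorphism for the mu_e-grading it defines, and all
    of X_e(R) for the universal grading. *)
Lemma common_eigen_grading (Y : (T -> T) -> Prop) (G : zmodType) (v : G -> (T -> T) -> algC) :
  (forall s, Y s -> isAut e phi i1 j s) ->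
  (forall g h s, v (g + h) s = v g s * v h s) ->
  (forall g s, Y s -> mu e (v g s)) ->
  (forall g h, g != h -> exists2 s, Y s & v g s != v h s) ->
  (forall r, exists l : seq (G * R),
     (forall p, p \in l -> forall s, Y s -> eigen j s (v p.1 s) (i1 p.2)) /\
     r = \sum_(p <- l) p.2) ->
  is_grading phi (fun g r => forall s, Y s -> eigen j s (v g s) (i1 r)).
Proof.
move=> YA vD vm vsep span.
have E0 g s : Y s -> eigen j s (v g s) (i1 0).
  by move=> Ys; rewrite (additive0 (tensor_i1D HT)); exact: eigen0 (YA s Ys).
have ED g x y : (forall s, Y s -> eigen j s (v g s) (i1 x)) ->
    (forall s, Y s -> eigen j s (v g s) (i1 y)) ->
    forall s, Y s -> eigen j s (v g s) (i1 (x + y)).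
  move=> xE yE s Ys; rewrite (tensor_i1D HT).
  by apply: (eigenD (YA s Ys)); [apply: xE|apply: yE].
split; last split; last split; last split.
- move=> g; split; first exact: E0; split=> [|c x xE s Ys]; first exact: ED.
  rewrite /eigen (tensor_i1M HT) (Aut_kscale _ _ (YA s Ys)) xE // !mulrA.
  by rewrite (tensor_comm HT) //; apply: Zmu_mu; apply: vm.
- move=> r; have [l [lP ->]] := span r.
  have [|||s [y [us _ yP ->]]] := @decomposition_group _ _
     (fun g r => forall s, Y s -> eigen j s (v g s) (i1 r)) l => //.
  by exists s, y.
- move=> l y ul yP sum0 g gl; apply: (tensor_i1_inj HT).
  move: g gl; apply: (common_eigen_independent Halg Rtf HT YA (v := v)) => //.
  + by move=> g s _; apply: vm.
  + by move=> g h _ _; apply: vsep.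
  + by move=> g s gl Ys; apply: yP.
  + by rewrite -(additive_sum (tensor_i1D HT)) sum0 (additive0 (tensor_i1D HT)).
- move=> s Ys; have v0 : v 0 s = 1.
    apply: (mulfI (mu_neq0 (vm 0 s Ys))).
    by rewrite -vD addr0 mulr1.
  rewrite /eigen v0 (tensor_i1_1 HT) (tensor_j1 HT) mulr1.
  by have [_ [_ [_ [-> _]]]] := YA s Ys.
- move=> g h x y xE yE s Ys; have [_ [_ [sM _]]] := YA s Ys.
  have [gE hE] := (Zmu_mu (vm g s Ys), Zmu_mu (vm h s Ys)).
  rewrite /eigen (tensor_i1M HT) sM xE // yE // vD (tensor_jM HT) //.
  by rewrite -!mulrA (mulrA (i1 x)) (tensor_comm HT) // !mulrA.
Qed.

Let X := Xe e phi i1 j.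

Lemma Xe_grading s : X s -> exists (G : zmodType) (Rg : G -> R -> Prop) (c : G -> algC),
  [/\ etorsion e G, is_grading phi Rg, character e c
    & forall g r, Rg g r -> s (i1 r) = j (c g) * i1 r].
Proof.
move=> sX; have [sA _] := sX.
(* G is mu_e in additive notation, and the character sought is its inclusion into [algC]. *)
have [||||G [v [v_inj vm v_surj vD]]] := @function_group unit (fun f => mu e (f tt)).
- exact: mu1.
- by move=> f g; apply: muM.
- by move=> f; apply: muV.
- by move=> f [] fm; apply: mu_neq0 fm.
exists G, (fun g r => forall s', s = s' -> eigen j s' (v g tt) (i1 r)), (fun g => v g tt).
split.
- move=> g; have [d [de gd]] := vm g; exists d; split=> //; apply: v_inj.
  have vX n : v (g *+ n.+1) tt = v g tt ^+ n.+1.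
    by elim: n => [//|n IH]; rewrite mulrS vD IH -exprS.
  have v0 : v 0 tt = 1.
    by apply: (mulfI (mu_neq0 (vm 0))); rewrite -[LHS]/((fun u => v 0 u * v 0 u) tt) -vD addr0 mulr1.
  apply: funext => -[]; rewrite v0; case: d de gd => [[]//|d] _ gd.
  by rewrite vX gd.
- apply: (common_eigen_grading (Y := eq s) (v := fun g _ => v g tt)) => //.
  + by move=> s' <-.
  + by move=> g h s'; rewrite vD.
  + move=> g h gh; exists s => //; apply: contra gh => /eqP vgh.
    by apply/eqP/v_inj/funext => -[].
  + move=> r; have [l [y [ul yP rE _]]] := Xe_components Halg Rtf HT r sX.
    have [z|w wP] := @choice algC G (fun z g => mu e z -> v g tt = z).
      have [zm|nz] := pselect (mu e z); last by exists 0.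
      by have [g gE] := v_surj (fun=> z) zm; exists g; rewrite gE.
    exists [seq (w z, y z) | z <- l]; rewrite big_map; split=> // p /mapP[z zl -> s' <- /=].
    by have [zm yz] := yP z zl; rewrite wP.
- by split=> // g h; rewrite vD.
- by move=> g r /(_ s erefl).
Qed.

Section Universal.
Variables (G0 : zmodType) (Rg0 : G0 -> R -> Prop).
Hypothesis univ : universal_grading e phi Rg0.

Let grad0 : is_grading phi Rg0. Proof. by case: univ => _ []. Qed.
Let is_tw := is_twist e i1 j Rg0.

(** The mu_e-grading of s is the push-forward of the universal one along some f, so s acts on degree
    g through the inclusion character at [f g]. *)
Lemma Xe_universal s : X s <-> exists2 c, character e c & is_tw c s.
Proof.
split=> [sX|[c c_char s_tw]]; last exact: (twist_Xe Halg Rtf HT grad0 c_char s_tw).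
have [sA _] := sX; have [G [Rg [c [Ge Rgg [cD cm] cs]]]] := Xe_grading sX.
have [_ [_ u]] := univ; have [f [[fD fpush] _]] := u G Rg Ge Rgg.
exists (fun g => c (f g)); first by split=> [g h|g]; rewrite ?fD ?cD.
split=> [x y|g r z gr zm]; first exact: (Aut_add _ _ sA).
have zE := Zmu_mu zm; have cE := Zmu_mu (cm (f g)).
rewrite (tensor_comm HT) // (Aut_scale Halg HT _ sA zE) (cs (f g)).
  by rewrite !mulrA -!(tensor_jM HT) // mulrC.
apply/fpush; exists [:: g], (fun=> r); rewrite big_seq1; split=> // h.
by rewrite inE => /eqP->.
Qed.

Lemma Xe_universal_subgroup : is_subgroup_A e phi i1 j X.
Proof.
split; first by move=> s [].
have cm c : character e c -> forall g : G0, mu e (c g) by case.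
split.
  apply/Xe_universal; exists (fun=> 1); last exact: (twist_id HT).
  by split=> [g h|g]; [rewrite mulr1|apply: mu1].
split=> [s t /Xe_universal[c cc s_tw] /Xe_universal[d dc t_tw]|].
  apply/Xe_universal; exists (fun g => c g * d g).
    by have [[cD ?] [dD ?]] := (cc, dc); split=> [g h|g]; [rewrite cD dD mulrACA|apply: muM].
  exact: (twist_comp Halg HT grad0 (cm c cc) (cm d dc) s_tw t_tw).
move=> s /Xe_universal[c cc s_tw]; have vc := characterV cc.
have [s' s'_tw] := twist_exists Halg HT grad0 (cm _ vc).
exists s'; first by apply/Xe_universal; exists (fun g => (c g)^-1).
split=> x.
  apply: (twist_unique Halg HT grad0 (twist_comp Halg HT grad0 (cm _ vc) (cm _ cc) s'_tw s_tw)).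
  by apply: (twist_id HT) => g; rewrite mulVf // (mu_neq0 (cm c cc g)).
apply: (twist_unique Halg HT grad0 (twist_comp Halg HT grad0 (cm _ cc) (cm _ vc) s_tw s'_tw)).
by apply: (twist_id HT) => g; rewrite mulfV // (mu_neq0 (cm c cc g)).
Qed.

Lemma Xe_universal_abelian : abelian_set X.
Proof.
move=> s t /Xe_universal[c [_ cm] s_tw] /Xe_universal[d [_ dm] t_tw] x.
have st_tw := twist_comp Halg HT grad0 cm dm s_tw t_tw.
have := twist_comp Halg HT grad0 dm cm t_tw s_tw.
rewrite (_ : (fun g => d g * c g) = fun g => c g * d g); last first.
  by apply: funext => g; rewrite mulrC.
by move=> ts_tw; apply: (twist_unique Halg HT grad0 st_tw ts_tw).
Qed.

(** An element of R' has finitely many degrees, so pointwise convergence of characters gives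
    convergence of their twists. *)
Lemma twist_finite_support x : exists gs : seq G0, forall c c' s s',
  is_tw c s -> is_tw c' s' -> (forall g, g \in gs -> c g = c' g) -> s x = s' x.
Proof.
have [l [lm ->]] := tensor_span HT x.
elim: l lm => [|p l IH] lm.
  exists [::] => c c' s s' [sD _] [s'D _] _.
  by rewrite !big_nil (additive0 sD) (additive0 s'D).
have [|gs gsP] := IH; first by move=> q ql; apply: lm; rewrite inE ql orbT.
have pm : mu e p.2 by apply: lm; rewrite inE eqxx.
have [_ _ span _] := grading_decomposition Halg grad0.
have [q [y [_ yP pE]]] := span p.1.
exists (q ++ gs) => c c' s s' s_tw s'_tw cc'.
have [[sD sE] [s'D s'E]] := (s_tw, s'_tw); rewrite big_cons sD s'D; congr (_ + _).
  rewrite pE (additive_sum (tensor_i1D HT)) mulr_suml (additive_sum sD) (additive_sum s'D).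
  rewrite !big_seq; apply: eq_bigr => g gq.
  by rewrite (sE g) ?(s'E g) ?cc' ?mem_cat ?gq //; apply: yP.
by apply: (gsP c c') => // g gs_g; apply: cc'; rewrite mem_cat gs_g orbT.
Qed.

Lemma ultra_finite_value (K : Type) (V : eqType) (F : set_system K) (f : K -> V) (l : seq V) :
  UltraFilter F -> F (fun c => f c \in l) -> exists z, F (fun c => f c = z).
Proof.
move=> FU; have FF : ProperFilter F by apply: ultra_proper.
elim: l => [|z l IH] Fl.
  exfalso; apply: (@filter_not_empty _ F FF); apply: filterS Fl => c.
  by rewrite in_nil.
have [Fz|Fz] := in_ultra_setVsetC (fun c => f c = z) FU; first by exists z.
apply: IH; apply: filterS (filterI Fl Fz) => c [+ /eqP fz].
by rewrite inE (negPf fz).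
Qed.

(* The characters form a closed subset of a product of finite sets: limit along an ultrafilter. *)
Lemma Xe_universal_compact : compactA e phi i1 j X.
Proof.
move=> I U Uopen Ucover; apply: contrapT => nofin.
(* Without a finite subcover, these sets of characters are nonempty for every l and generate a
   proper filter. *)
pose avoid (l : list I) (c : G0 -> algC) :=
  character e c /\ forall s, is_tw c s -> forall i, List.In i l -> ~ U i s.
pose F0 : set_system (G0 -> algC) := fun A => exists l, forall c, avoid l c -> A c.
have F0P : ProperFilter F0.
  split.
    move=> [l lP]; apply: nofin; exists l => s sX; apply: contrapT => nU.
    have [c cc s_tw] := (Xe_universal s).1 sX; apply: (lP c); split=> // s' s'_tw i il Us'.
    apply: nU; exists i; split=> //; rewrite (_ : s = s') //; apply: funext.
    exact: (twist_unique Halg HT grad0 s_tw s'_tw).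
  split=> [|A B [l lA] [l' lB]|A B AB [l lA]].
  - by exists nil.
  - exists (l ++ l')%list => c [cc cP]; split.
      by apply: lA; split=> // s s_tw i il; apply: cP => //; apply/List.in_or_app; left.
    by apply: lB; split=> // s s_tw i il; apply: cP => //; apply/List.in_or_app; right.
  - by exists l => c /lA/AB.
have [F [FU F0F]] := ultraFilterLemma F0P.
have FF : ProperFilter F by apply: ultra_proper.
have Fchar : F (@character e G0) by apply: F0F; exists nil => c [].
have [Ge _] := univ.
(* If d kills g, then c(g) is one of the d roots of unity of order dividing d. *)
have lim g : exists z, F (fun c => c g = z).
  have [d [de gd]] := Ge g; have d0 := steinitz_dvd_gt0 de.
  have [w w_prim] := C_prim_root_exists d0.
  apply: (ultra_finite_value (l := [seq w ^+ i | i <- iota 0 d]) FU).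
  apply: filterS Fchar => c cc.
  have cd : c g ^+ d = 1.
    have cX n : c (g *+ n) = c g ^+ n.
      elim: n => [|n IH]; first by rewrite mulr0n expr0 (character0 cc).
      by have [cD _] := cc; rewrite mulrS cD IH exprS.
    by rewrite -cX gd (character0 cc).
  have [i iE] := prim_rootP w_prim cd; apply/mapP; exists (val i) => //.
  by rewrite mem_iota ltn_ord.
have [c cF] := choice lim.
have c_char : character e c.
  split=> [g h|g].
    have [c' [[cg' ch'] [cgh' [cD' _]]]] :=
      filter_ex (filterI (filterI (cF g) (cF h)) (filterI (cF (g + h)) Fchar)).
    by rewrite -cgh' cD' cg' ch'.
  have [c' [cg' [_ cm']]] := filter_ex (filterI (cF g) Fchar).
  by rewrite -cg'.
have [s s_tw] := twist_exists Halg HT grad0 c_char.2.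
have sX : X s by apply/Xe_universal; exists c.
have [i Us] := Ucover s sX; have [sA _] := sX.
have [xs xsP] := Uopen i s sA Us.
(* Almost all characters have twists agreeing with s on [xs], hence lying in [U i], while almost all
   avoid [U i]. *)
have Fxs : F (fun c' => forall s', is_tw c' s' -> forall x, x \in xs -> s' x = s x).
  elim: xs {xsP} => [|x xs IH]; first exact: filterE.
  have [gs gsP] := twist_finite_support x.
  have Fgs : F (fun c' => forall g, g \in gs -> c' g = c g).
    elim: (gs) => [|g l IHl]; first exact: filterE.
    apply: filterS (filterI (cF g) IHl) => c' [cg' cl'] h.
    by rewrite inE => /orP[/eqP->|/cl'].
  apply: filterS (filterI IH Fgs) => c' [cx cgs] s' s'_tw y.
  rewrite inE => /orP[/eqP->|]; last exact: cx.
  exact: (gsP c' c).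
have Fi : F (avoid [:: i]%list) by apply: F0F; exists [:: i]%list.
have [c' [cxs [cc' nU]]] := filter_ex (filterI Fxs Fi).
have [s' s'_tw] := twist_exists Halg HT grad0 cc'.2.
apply: (nU s' s'_tw i); first by left.
apply: xsP => [|x]; last exact: cxs.
have : X s' by apply/Xe_universal; exists c'.
by case.
Qed.

End Universal.
End FromUniversal.

(** * From a compact abelian X_e(R) to a universal grading *)

Section CharactersSeparate.
Variables (e : steinitz) (G : zmodType).
Hypothesis Ge : etorsion e G.

Let graph := set (G * algC).

(** Graph of a mu_e-valued character on a subgroup; closure under differences and the third clause
    make it single-valued. Graphs allow unions of chains. *)
Let pchar (B : graph) : Prop :=
  [/\ B (0, 1), forall p q, B p -> B q -> B (p.1 - q.1, p.2 / q.2),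
      forall z, B (0, z) -> z = 1 & forall p, B p -> mu e p.2].

Let ext (B : graph) (x : G) (w : algC) : graph :=
  fun p => exists y z n, B (y, z) /\ p = (y + x *+ n, z * w ^+ n).

Let pcharN B y z : pchar B -> B (y, z) -> B (- y, z^-1).
Proof. by move=> [B1 BB _ _] /(BB _ _ B1) /=; rewrite sub0r mul1r. Qed.

Let pcharD B y z y' z' : pchar B -> B (y, z) -> B (y', z') -> B (y + y', z * z').
Proof.
move=> Bc Byz /(pcharN Bc); case: Bc => _ BB _ _ /(BB _ _ Byz) /=.
by rewrite opprK invrK.
Qed.

Let pcharMn B y z n : pchar B -> B (y, z) -> B (y *+ n, z ^+ n).
Proof.
move=> Bc Byz; elim: n => [|n IH]; first by rewrite mulr0n expr0; case: Bc.
by rewrite mulrS exprS; apply: pcharD.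
Qed.

Let pchar_fun B y z z' : pchar B -> B (y, z) -> B (y, z') -> z = z'.
Proof.
move=> Bc Bz Bz'; case: (Bc) => _ BB B0 Bm.
have := BB _ _ Bz Bz'; rewrite /= subrr => /B0 zz'.
by rewrite -[z](divfK (mu_neq0 (Bm _ Bz'))) /= zz' mul1r.
Qed.

(** Let N > 1 be least with N x in the domain and c the value there. Any N-th root w of c extends
    the character to x, and it lies in mu_e because x is torsion. *)
Let pchar_ext B x : pchar B -> (forall z, ~ B (x, z)) ->
  exists w, w != 1 /\ pchar (ext B x w).
Proof.
move=> Bc xB; have [B1 BB B0 Bm] := Bc; have [d [de xd]] := Ge x.
have d0 := steinitz_dvd_gt0 de.
pose Q n := (0 < n)%N && `[< exists z, B (x *+ n, z) >].
have Qd : Q d by rewrite /Q d0; apply/asboolP; exists 1; rewrite xd.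
case: (ex_minnP (ex_intro Q d Qd)) => N /andP[N0 /asboolP[c Nc]] Nmin.
have N_dvd n z : B (x *+ n, z) -> (N %| n)%N /\ z = c ^+ (n %/ N).
  move=> nz; have qc := pcharMn (n %/ N) Bc Nc.
  have rz : B (x *+ (n %% N), z / c ^+ (n %/ N)).
    have := BB _ _ nz qc; rewrite /= -mulrnA {1}(divn_eq n N) mulrnDr.
    by rewrite [(N * _)%N]mulnC (addrC (x *+ (n %/ N * N))) addrK.
  have r0 : (n %% N)%N = 0%N.
    apply/eqP; rewrite -leqn0 leqNgt; apply/negP => r0.
    have : (N <= n %% N)%N by apply: Nmin; rewrite /Q r0; apply/asboolP; exists (z / c ^+ (n %/ N)).
    by rewrite leqNgt ltn_mod N0.
  split; first by rewrite /dvdn r0.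
  have := B0 _ (_ : B (0, z / c ^+ (n %/ N))); rewrite r0 mulr0n in rz => /(_ rz) zc.
  by rewrite -[LHS](divfK (mu_neq0 (Bm _ qc))) /= zc mul1r.
have N1 : (1 < N)%N.
  rewrite ltn_neqAle N0 andbT; apply/eqP => N1; apply: (xB c).
  by move: Nc; rewrite -N1 mulr1n.
(* If the principal root is 1 then c = 1, and a primitive N-th root of unity serves instead. *)
have [w [wN w1]] : exists w, w ^+ N = c /\ w != 1.
  have [r1|r1] := eqVneq (N.-root c) 1; last by exists (N.-root c); rewrite rootCK.
  have c1 : c = 1 by rewrite -(rootCK N0 c) r1 expr1n.
  have [w w_prim] := C_prim_root_exists N0; exists w.
  rewrite c1 (prim_expr_order w_prim); split=> //.
  by rewrite -[w]expr1 -(prim_order_dvd w_prim) dvdn1 gtn_eqF.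
have wn n z : B (x *+ n, z) -> w ^+ n = z.
  by move=> /N_dvd[Nn ->]; rewrite -wN -exprM mulnC divnK.
have wd : w ^+ d = 1 by apply: wn; rewrite xd.
have wm : mu e w by exists d.
exists w; split=> //; split.
- by exists 0, 1, 0%N; rewrite mulr0n addr0 mulr1.
- move=> _ _ [y [z [n [yz ->]]]] [y' [z' [n' [yz' ->]]]] /=.
  (* [ext] uses natural multiples only; as d x = 0, subtracting x amounts to adding it d - 1
     times. *)
  exists (y - y'), (z / z'), (n + n' * d.-1)%N; split; first exact: (BB _ _ yz yz').
  have xn' : x *+ (n' * d.-1) = - (x *+ n').
    apply/eqP; rewrite -addr_eq0 -mulrnDr -[X in (_ + X)%N]muln1 -mulnDr addn1 prednK //.
    by rewrite mulnC mulrnA xd mul0rn.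
  have wn' : w ^+ (n' * d.-1) = (w ^+ n')^-1.
    apply: (mulIf (mu_neq0 (muX n' wm))); rewrite mulVf ?(mu_neq0 (muX n' wm)) //.
    by rewrite -exprD -[X in (_ + X)%N]muln1 -mulnDr addn1 prednK // mulnC exprM wd expr1n.
  by rewrite mulrnDr xn' exprD wn' invfM opprD addrACA mulrACA.
- move=> _ [y [z [n [yz [y0 ->]]]]].
  have ny : x *+ n = - y by apply/eqP; rewrite -addr_eq0 addrC -y0.
  rewrite (wn n z^-1) ?mulfV ?(mu_neq0 (Bm _ yz)) //.
  by rewrite ny; apply: pcharN.
- move=> _ [y [z [n [yz ->]]]] /=; apply: muM; first exact: (Bm _ yz).
  exact: muX.
Qed.

(** The trivial character of 0 is extended to g with a value other than 1, then to the whole group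
    by Zorn's lemma. *)
Lemma characters_separate_0 g : g != 0 -> exists2 c : G -> algC, character e c & c g != 1.
Proof.
move=> g0; pose triv : graph := fun p => p = (0, 1).
have trivP : pchar triv.
  split=> //; first by move=> p q -> ->; rewrite /triv /= subr0 divr1.
    by move=> z [].
  by move=> p -> /=; apply: mu1.
have [|w0 [w01 B0c]] := pchar_ext (x := g) trivP.
  by move=> z [/eqP]; rewrite (negPf g0).
pose B0 := ext triv g w0; rewrite -/B0 in B0c.
have B0g : B0 (g, w0) by exists 0, 1, 1%N; rewrite add0r mul1r.
(* Zorn's lemma here includes the empty chain, so the condition is imposed on the union of A with
   the initial graph [B0]. *)
pose M (A : graph) : graph := fun p => A p \/ B0 p.
have chain (F : set graph) : (forall A, F A -> pchar (M A)) -> total_on F subset ->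
    pchar (M (\bigcup_(A in F) A)%classic).
  move=> FP Ftot; pose U := (\bigcup_(A in F) A)%classic.
  have UM A : F A -> (forall p, M A p -> M U p) by move=> FA p [Ap|]; [left; exists A|right].
  have one p : M U p -> B0 p \/ exists2 A, F A & M A p.
    by move=> [[A FA Ap]|]; [right; exists A => //; left|left].
  have two p q : M U p -> M U q ->
      (B0 p /\ B0 q) \/ exists A, [/\ F A, M A p & M A q].
    move=> [[A FA Ap]|Bp] [[A' FA' Aq]|Bq].
    - by right; have [AA|AA] := Ftot _ _ FA FA'; [exists A'|exists A]; split=> //; left=> //; apply: AA.
    - by right; exists A; split=> //; [left|right].
    - by right; exists A'; split=> //; [right|left].
    - by left.
  have [B1 BB BZ Bm] := B0c; split.
  - by right.
  - move=> p q /two h /h[[Bp Bq]|[A [FA Ap Aq]]]; first by right; apply: BB.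
    by apply: (UM A FA); have [_ AB _ _] := FP A FA; apply: AB.
  - by move=> z /one[/BZ//|[A FA]]; have [_ _ AZ _] := FP A FA; apply: AZ.
  - by move=> p /one[/Bm//|[A FA]]; have [_ _ _ Am] := FP A FA; apply: Am.
have [A [AP Amax]] := Zorn_bigcup (P := fun A => pchar (M A)) chain.
have [x|c cP] := choice (fun x => _ : exists z, M A (x, z)).
  apply: contrapT => xA.
  have [|w [_ extP]] := pchar_ext (x := x) AP; first by move=> z xz; apply: xA; exists z.
  have Mext p : M A p -> ext (M A) x w p.
    by case: p => y z yz; exists y, z, 0%N; rewrite mulr0n addr0 mulr1.
  have xw : ext (M A) x w (x, w).
    by exists 0, 1, 1%N; split; [case: AP|rewrite add0r mul1r].
  apply: (Amax (ext (M A) x w)).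
    split=> [p Ap|sub]; first by apply: Mext; left.
    by apply: xA; exists w; left; apply: sub.
  rewrite (_ : M _ = ext (M A) x w) //; apply/seteqP; split=> p; last by left.
  by case=> // Bp; apply: Mext; right.
have [_ _ _ Am] := AP.
exists c; last by rewrite (pchar_fun AP (cP g) (or_intror B0g)).
split=> [x y|x]; last exact: (Am _ (cP x)).
exact: (pchar_fun AP (cP (x + y)) (pcharD AP (cP x) (cP y))).
Qed.

Lemma characters_separate g h : (forall c : G -> algC, character e c -> c g = c h) -> g = h.
Proof.
move=> gh; apply/eqP; rewrite -subr_eq0; apply: contraT => /characters_separate_0[c cc].
have [cD cm] := cc; have := cD (g - h) h; rewrite subrK gh // => ch.
by rewrite -(inj_eq (mulIf (mu_neq0 (cm h)))) -ch mul1r eqxx.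
Qed.

End CharactersSeparate.

Lemma grading_components (k : comPzRingType) (R : pzRingType) (phi : k -> R)
    (G : zmodType) (Rg : G -> R -> Prop) : is_kalg phi -> is_grading phi Rg ->
  exists pr : G -> R -> R,
   [/\ forall g x y, pr g (x + y) = pr g x + pr g y,
       forall g r, Rg g r -> pr g r = r,
       forall g h r, g != h -> Rg h r -> pr g r = 0,
       forall g r, Rg g (pr g r)
     & forall r, exists s, r = \sum_(g <- s) pr g r].
Proof.
move=> Halg HG; have dec := grading_decomposition Halg HG.
have [g|pr prP] := @choice G (R -> R) (fun g p => (forall x y, p (x + y) = p x + p y) /\
    forall h r, Rg h r -> p r = if h == g then r else 0).
  apply: (decomposition_extend dec (W := R) (F := fun h r => if h == g then r else 0)).
  by move=> h x y; case: eqP; rewrite ?addr0.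
have [R0 _ span _] := dec.
have prE g s y : uniq s -> (forall h, h \in s -> Rg h (y h)) ->
    pr g (\sum_(h <- s) y h) = if g \in s then y g else 0.
  move=> us yP; rewrite (additive_sum (prP g).1).
  transitivity (\sum_(h <- s) if h == g then y h else 0).
    by rewrite !big_seq; apply: eq_bigr => h /yP/(prP g).2.
  case: ifP => gs.
    by rewrite (bigD1_seq g) //= eqxx big1 ?addr0 // => h /negPf->.
  by rewrite big_seq big1 // => h hs; case: eqP => // hg; rewrite -hg hs in gs.
exists pr; split=> [g|g r gr|g h r gh hr|g r|r].
- exact: (prP g).1.
- by rewrite ((prP g).2 g) ?eqxx.
- by rewrite ((prP g).2 h) // eq_sym (negPf gh).
- have [s [y [us yP ->]]] := span r; rewrite prE //.
  by case: ifP => [/yP|_].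
- have [s [y [us yP rE]]] := span r; exists s.
  by rewrite {1}rE !big_seq; apply: eq_bigr => g gs; rewrite rE prE ?gs.
Qed.

Definition sum_of (V : zmodType) (P : V -> Prop) (x : V) : Prop :=
  exists l : seq V, (forall y, y \in l -> P y) /\ x = \sum_(y <- l) y.

Lemma sum_of_bind (V : zmodType) (P Q : V -> Prop) x :
  sum_of P x -> (forall y, P y -> sum_of Q y) -> sum_of Q x.
Proof.
move=> [l [lP ->]] PQ; elim: l lP => [|y l IH] lP; first by exists [::]; rewrite !big_nil.
have [|l1 [l1Q l1E]] := IH; first by move=> z zl; apply: lP; rewrite inE zl orbT.
have [|l2 [l2Q l2E]] := PQ y; first by apply: lP; rewrite inE eqxx.
exists (l2 ++ l1); rewrite big_cons big_cat l1E -l2E; split=> // z.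
by rewrite mem_cat => /orP[/l2Q|/l1Q].
Qed.

(** * Weights of a compact abelian X_e(R) and the grading they define *)

Section FromCompact.
Variables (e : steinitz) (k : comPzRingType) (R : pzRingType) (phi : k -> R).
Hypothesis Halg : is_kalg phi.
Hypothesis Rtf : forall d : nat, steinitz_dvd d e -> injective (fun r : R => r *+ d).
Variables (T : pzRingType) (i1 : R -> T) (j : algC -> T).
Hypothesis HT : is_tensor e i1 j.

(** The projection p onto degree g extends to P on R' with P s = c(g) P. Hence c(g) and w act alike
    on P (i1 r), which vanishes as they differ. *)
Lemma twist_component (G : zmodType) (Rg : G -> R -> Prop) (c : G -> algC) s w r g (p : R -> R) :
  is_grading phi Rg -> (forall g, mu e (c g)) -> is_twist e i1 j Rg c s -> mu e w ->
  (forall x y, p (x + y) = p x + p y) -> (forall r, Rg g r -> p r = r) ->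
  (forall h r, g != h -> Rg h r -> p r = 0) ->
  eigen j s w (i1 r) -> c g != w -> p r = 0.
Proof.
move=> HG cm s_tw wm pD pg p0 rw cw; have [sD sE] := s_tw.
have [||P [PD PE]] := tensor_map HT (beta := fun r z => i1 (p r) * j z).
- by move=> x y z _; rewrite pD (tensor_i1D HT) mulrDl.
- by move=> x z z' zE z'E; rewrite (tensor_jD HT) // mulrDr.
have P1 x : P (i1 x) = i1 (p x).
  by rewrite -[i1 x]mulr1 -(tensor_j1 HT) PE ?(tensor_j1 HT) ?mulr1 //; apply: Zmu1.
have Ps : (fun x => P (s x)) =1 (fun x => j (c g) * P x).
  apply: (graded_tensor_ext Halg HT HG) => [x y|x y|h x z hx zm].
  - by rewrite sD PD.
  - by rewrite PD mulrDr.
  have [zE hE] := (Zmu_mu zm, Zmu_mu (cm h)).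
  rewrite (sE h) // mulrA -(tensor_comm HT) // -mulrA -(tensor_jM HT) // !PE //; last exact: ZmuM.
  have [<-|gh] := eqVneq g h.
    by rewrite (tensor_jM HT) ?mulrA ?(tensor_comm HT) //; apply: Zmu_mu.
  by rewrite (p0 h) // (additive0 (tensor_i1D HT)) !mul0r mulr0.
apply: (tensor_i1_inj HT); apply: (tensor_root_separation HT Rtf (cm g) wm cw).
have wE := Zmu_mu wm.
rewrite -P1 -Ps rw -(tensor_comm HT) // PE // P1.
exact: (tensor_comm HT).
Qed.

Let X := Xe e phi i1 j.
Hypothesis Xsub : is_subgroup_A e phi i1 j X.
Hypothesis Xab : abelian_set X.
Hypothesis Xcomp : compactA e phi i1 j X.

Let XA s : X s -> isAut e phi i1 j s. Proof. by case: Xsub => + _; apply. Qed.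

(** The sets of f with f x = y, for varying y, form an open cover; a finite subcover bounds the
    orbit. *)
Lemma Xe_orbit_finite x : exists ss : list (T -> T),
  (forall s, List.In s ss -> X s) /\
  forall s, X s -> exists2 s', List.In s' ss & s x = s' x.
Proof.
have [||l lP] := Xcomp (I := T) (U := fun y f => f x = y).
- move=> y f fA fx; exists [:: x] => g gA gf.
  by rewrite gf // inE.
- by move=> f _; exists (f x).
suff [ss [ssX ssP]] : exists ss : list (T -> T), (forall s, List.In s ss -> X s) /\
    forall s, X s -> List.In (s x) l -> exists2 s', List.In s' ss & s x = s' x.
  by exists ss; split=> // s sX; have [y [yl sy]] := lP s sX; apply: ssP => //; rewrite sy.
elim: {lP} l => [|y l [ss [ssX ssP]]]; first by exists nil.
have [[s0 [s0X s0x]]|no] := pselect (exists s, X s /\ s x = y).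
  exists (s0 :: ss)%list; split=> [s [<-|/ssX]|s sX [sx|/(ssP _ sX)[s' s'ss sx]]] //.
    by exists s0; [left|rewrite s0x].
  by exists s' => //; right.
exists ss; split=> // s sX [sx|/(ssP _ sX)//].
by case: no; exists s.
Qed.

Let refines r x := forall s w, X s -> mu e w -> eigen j s w (i1 r) -> eigen j s w (i1 x).

(** Splitting by one s after another keeps the earlier eigenvector properties because X is
    commutative. [refines] further records that the pieces inherit all eigenvalues of r, also for
    automorphisms outside [ss]. *)
Lemma Xe_finite_decomposition (ss : list (T -> T)) r : (forall s, List.In s ss -> X s) ->
  sum_of (fun x => refines r x /\
    forall s, List.In s ss -> exists2 w, mu e w & eigen j s w (i1 x)) r.
Proof.
elim: ss => [|s ss IH] ssX.
  by exists [:: r]; rewrite big_seq1; split=> // y; rewrite inE => /eqP->; split.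
have sX : X s by apply: ssX; left.
apply: (sum_of_bind (IH _)) => [s' s's|x [rx xP]]; first by apply: ssX; right.
have [l [y [ul yP xE yr]]] := Xe_components Halg Rtf HT x sX.
exists [seq y z | z <- l]; rewrite big_map; split=> // _ /mapP[z zl ->].
have [zm yz] := yP z zl.
have xy : refines x (y z).
  move=> s' w s'X wm xw; apply: (yr s' w (XA s'X) _ wm xw) => // u.
  exact: (Xab sX s'X u).
split=> [s' w s'X wm rw|s' [<-|s's]]; first by apply: xy => //; apply: rx.
  by exists z.
have [w wm xw] := xP s' s's; exists w => //; apply: xy => //.
by apply: ssX; right.
Qed.

(** The value 1 outside X makes a weight determined by its restriction to X. *)
Let weight (c : (T -> T) -> algC) (x : R) :=
  (forall s, X s -> mu e (c s) /\ eigen j s (c s) (i1 x)) /\ forall s, ~ X s -> c s = 1.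

(** Splitting by representatives of the orbit of [i1 r] suffices: any s in X agrees on [i1 r] with a
    representative s', so the inverse of s' composed with s fixes [i1 r], hence each piece, and s
    acts on the piece as s' does. *)
Lemma Xe_weight_decomposition r : sum_of (fun x => exists c, weight c x) r.
Proof.
have [ss [ssX ssP]] := Xe_orbit_finite (i1 r).
apply: (sum_of_bind (Xe_finite_decomposition r ssX)) => x [rx xP].
exists [:: x]; rewrite big_seq1; split=> // _ /[!inE]/eqP->.
have [s|c cP] := @choice (T -> T) algC (fun s w =>
    (X s -> mu e w /\ eigen j s w (i1 x)) /\ (~ X s -> w = 1)).
  have [sX|sX] := pselect (X s); last by exists 1.
  have [s' s'ss sr] := ssP s sX; have s'X := ssX s' s'ss.
  have [w wm xw] := xP s' s'ss; exists w; split=> // _; split=> //.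
  have [_ [_ [Xcomp' Xinv]]] := Xsub; have [u uX [us' s'u]] := Xinv s' s'X.
  have xfix : eigen j (u \o s) 1 (i1 x).
    apply: rx; [exact: Xcomp'|exact: mu1|].
    by rewrite /eigen /= sr us' (tensor_j1 HT) mul1r.
  have usx : u (s (i1 x)) = i1 x by move: xfix; rewrite /eigen (tensor_j1 HT) mul1r.
  by rewrite /eigen -[LHS]s'u usx.
by exists c; split=> s sX; have [c1 c2] := cP s; [apply: c1|apply: c2].
Qed.

(** Where c takes different values, the images of the nonzero [i1 x] differ. A finite orbit thus
    leaves finitely many values of c, and these have a common order. *)
Lemma weight_torsion c x : weight c x -> x <> 0 ->
  exists d, steinitz_dvd d e /\ forall s, c s ^+ d = 1.
Proof.
move=> [cX c1] x0; have [ss [ssX ssP]] := Xe_orbit_finite (i1 x).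
have cm s : mu e (c s).
  by have [/cX[]//|/c1->] := pselect (X s); apply: mu1.
have [|d [de dP]] := @mu_common_order e [seq c s | s <- ss].
  elim: (ss) => //= s l IH z; rewrite inE => /orP[/eqP->|/IH//].
  exact: cm.
have dss s : List.In s ss -> c s ^+ d = 1.
  move=> sss; apply: dP; elim: (ss) sss => //= s' l IH [->|/IH cl].
    by rewrite inE eqxx.
  by rewrite inE cl orbT.
exists d; split=> // s; have [sX|/c1->] := pselect (X s); last exact: expr1n.
have [s' s'ss sx] := ssP s sX; rewrite -(dss s' s'ss).
have [->//|cs] := eqVneq (c s) (c s'); case: x0.
apply: (tensor_i1_inj HT); apply: (tensor_root_separation HT Rtf (cm s) (cm s') cs).
have [_ <-] := cX s sX; have [_ <-] := cX s' (ssX s' s'ss).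
exact: sx.
Qed.

Let gen (c : (T -> T) -> algC) := forall S : ((T -> T) -> algC) -> Prop,
  S (fun=> 1) -> (forall c d, S c -> S d -> S (fun s => c s * d s)) ->
  (forall c, S c -> S (fun s => (c s)^-1)) ->
  (forall c x, weight c x -> x <> 0 -> S c) -> S c.

Let gen_order c : gen c -> exists d, steinitz_dvd d e /\ forall s, c s ^+ d = 1.
Proof.
move=> /(_ (fun c => exists d, steinitz_dvd d e /\ forall s, c s ^+ d = 1)); apply.
- by exists 1%N; split=> [|s]; [apply: steinitz_dvd1|rewrite expr1n].
- move=> c1 c2 [d [de cd]] [n [ne cn]]; exists (lcmn d n); split=> [|s].
    exact: steinitz_dvd_lcm.
  by rewrite exprMn (expr_dvd (cd s) (dvdn_lcml _ _)) (expr_dvd (cn s) (dvdn_lcmr _ _)) mulr1.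
- by move=> c1 [d [de cd]]; exists d; split=> // s; rewrite exprVn cd invr1.
- exact: weight_torsion.
Qed.

Let gen_mu c s : gen c -> mu e (c s).
Proof. by move=> /gen_order[d [de cd]]; exists d. Qed.

Let gen_out c s : gen c -> ~ X s -> c s = 1.
Proof.
move=> + sX; move=> /(_ (fun c => c s = 1)); apply=> //.
- by move=> c1 c2 -> ->; rewrite mulr1.
- by move=> c1 ->; rewrite invr1.
- by move=> c1 x [_ +] _; apply.
Qed.

Lemma has_universal_grading_of_compact : has_universal_grading e phi.
Proof.
have [||||G0 [v [v_inj v_gen v_surj vD]]] := @function_group (T -> T) gen.
- by move=> S S1.
- move=> c1 c2 c1g c2g S S1 SM SV Sw.
  exact: (SM _ _ (c1g S S1 SM SV Sw) (c2g S S1 SM SV Sw)).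
- by move=> c1 c1g S S1 SM SV Sw; apply: (SV _ (c1g S S1 SM SV Sw)).
- by move=> c1 s c1g; apply: mu_neq0 (gen_mu s c1g).
have vDs g h s : v (g + h) s = v g s * v h s by rewrite vD.
have v0 s : v 0 s = 1.
  apply: (mulfI (mu_neq0 (gen_mu s (v_gen 0)))).
  by rewrite -vDs addr0 mulr1.
have v_weight c x : weight c x -> x <> 0 -> exists g, v g = c.
  by move=> cx x0; apply: v_surj => S S1 SM SV Sw; apply: Sw cx x0.
pose Rg0 g r := forall s, X s -> eigen j s (v g s) (i1 r).
have grad0 : is_grading phi Rg0.
  apply: (common_eigen_grading Halg Rtf HT) => //.
  - by move=> g s _; apply: gen_mu.
  - move=> g h gh; apply: contrapT => no; case/eqP: gh; apply: v_inj; apply: funext => s.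
    have [sX|sX] := pselect (X s); last by rewrite !gen_out.
    by apply/eqP; apply: contrapT => /negP vs; apply: no; exists s.
  - move=> r; have [l [lP ->]] := Xe_weight_decomposition r.
    have [x|g gP] := @choice R G0 (fun x g => x \in l -> forall s, X s -> eigen j s (v g s) (i1 x)).
      have [xl|] := boolP (x \in l); last by exists 0.
      (* A zero summand may carry a weight outside the group; it is put in degree 0. *)
      have [->|/eqP x0] := eqVneq x 0.
        by exists 0 => _ s sX; rewrite (additive0 (tensor_i1D HT)); exact: eigen0 (XA sX).
      have [c cx] := lP x xl; have [g gc] := v_weight c x cx x0.
      by exists g => _ s sX; rewrite gc; case: cx => /(_ s sX)[].
    exists [seq (g x, x) | x <- l]; rewrite big_map; split=> // p /mapP[x xl ->] /=.
    exact: gP.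
exists G0, Rg0; split; [|split=> //].
  move=> g; have [d [de gd]] := gen_order (v_gen g); exists d; split=> //.
  apply: v_inj; apply: funext => s; rewrite v0 -(gd s).
  elim: d {de gd} => [|d IH]; first by rewrite mulr0n v0.
  by rewrite mulrS vDs IH exprS.
move=> G Rg Ge HG.
have [pr [prD pr_id pr_0 prR pr_span]] := grading_components Halg HG.
pose is_tw := is_twist e i1 j Rg.
have twX c s : character e c -> is_tw c s -> X s by apply: (twist_Xe Halg Rtf HT HG).
have tw_ex c : character e c -> exists s, is_tw c s.
  by move=> [_ cm]; apply: (twist_exists Halg HT HG).
(* Evaluating f at the twists of characters of G is evaluation of these characters at g. *)
pose dual (f : (T -> T) -> algC) g :=
  forall c s, character e c -> is_tw c s -> f s = c g.
have dual_uniq f g h : dual f g -> dual f h -> g = h.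
  move=> fg fh; apply: (characters_separate Ge) => c cc; have [s s_tw] := tw_ex c cc.
  by rewrite -(fg c s cc s_tw) -(fh c s cc s_tw).
have component f x g : (forall s, X s -> mu e (f s) /\ eigen j s (f s) (i1 x)) ->
    ~ dual f g -> pr g x = 0.
  move=> fx /existsNP[c /existsNP[s /not_implyP[cc /not_implyP[s_tw /eqP fs]]]].
  have [fm xs] := fx s (twX c s cc s_tw).
  apply: (twist_component HG cc.2 s_tw fm (prD g) (pr_id g) _ xs); last by rewrite eq_sym.
  by move=> h r; apply: pr_0.
(* A weight of a nonzero x has a dual, since otherwise [component] would kill every component of x;
   products and inverses of weights follow. *)
have dual_ex f : gen f -> exists g, dual f g.
  move=> /(_ (fun f => exists g, dual f g)); apply.
  - by exists 0 => c s cc _; rewrite (character0 cc).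
  - move=> c1 c2 [g gP] [h hP]; exists (g + h) => c s cc s_tw.
    by rewrite (gP c s cc s_tw) (hP c s cc s_tw) cc.1.
  - move=> c1 [g gP]; exists (- g) => c s cc s_tw; have [cD cm] := cc.
    apply: (mulfI (mu_neq0 (cm g))); rewrite -cD subrr (character0 cc) (gP c s cc s_tw).
    by rewrite mulfV // (mu_neq0 (cm g)).
  - move=> c x [cx _] x0; apply: contrapT => no; apply: x0.
    have [s ->] := pr_span x; rewrite big1 // => g _.
    by apply: (component c) => // cg; apply: no; exists g.
have [f fP] := choice (fun g => dual_ex (v g) (v_gen g)).
have fD x y : f (x + y) = f x + f y.
  apply: dual_uniq (fP (x + y)) _ => c s cc s_tw.
  by rewrite vDs (fP x c s cc s_tw) (fP y c s cc s_tw) cc.1.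
(* By [component] and the uniqueness of duals, r has no component outside degree [f g]. *)
have f_sub g r : Rg0 g r -> Rg (f g) r.
  move=> gr; rewrite (_ : r = pr (f g) r); first exact: prR.
  have pr_ne h : h != f g -> pr h r = 0.
    move=> hf; apply: (component (v g)) => [s sX|gh].
      by split; [apply: gen_mu|apply: gr].
    by case/eqP: hf; apply: dual_uniq gh (fP g).
  have [_ [span _]] := HG; have [s [y [us [yP rE]]]] := span r.
  have prs h : pr h r = if h \in s then y h else 0.
    rewrite rE (additive_sum (prD h)); case: ifP => hs.
      rewrite (bigD1_seq h) //= (pr_id h _ (yP h hs)) big_seq_cond big1 ?addr0 // => h' /andP[h's h'h].
      by apply: (pr_0 _ h'); [rewrite eq_sym|apply: yP].
    rewrite big_seq big1 // => h' h's; apply: (pr_0 _ h'); last exact: yP.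
    by apply: contraFneq hs => ->.
  have [fs|fs] := boolP (f g \in s).
    rewrite {1}rE (bigD1_seq (f g)) //= big_seq_cond big1 ?addr0 => [|h /andP[hs hf]].
      by rewrite prs fs.
    by have := pr_ne h hf; rewrite prs hs.
  rewrite {1}rE big_seq big1 ?prs ?(negPf fs) // => h hs.
  have := pr_ne h; rewrite prs hs; apply.
  by apply: contraNneq fs => <-.
have [R0 _ _ _] := grading_decomposition Halg HG.
have RgD := decomposition_add (grading_decomposition Halg HG).
exists f; split; first split=> // d r.
  split=> [[s [y [sP ->]]]|dr].
    rewrite big_seq; apply: (big_ind (Rg d)) => // [x y'|g gs]; first exact: RgD.
    by have [<- gy] := sP g gs; apply: f_sub.
  (* Projecting the weight decomposition of r to degree d keeps exactly the summands with
     [f g = d]. *)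
  have [_ [span0 _]] := grad0; have [s [y [us [yP rE]]]] := span0 r.
  exists [seq g <- s | f g == d], y; split=> [g|].
    by rewrite mem_filter => /andP[/eqP fg /yP].
  rewrite big_filter -(pr_id d r dr) {1}rE (additive_sum (prD d)) [RHS]big_mkcond /=.
  rewrite !big_seq; apply: eq_bigr => g gs; have yg := f_sub _ _ (yP g gs).
  case: eqP => [fg|/eqP fg]; first by rewrite pr_id // -fg.
  by apply: (pr_0 _ (f g)) => //; rewrite eq_sym.
move=> f' f'D f'push.
(* On a generator, a nonzero x of that weight lies in both [Rg (f g)] and [Rg (f' g)], which meet in
   0 unless the degrees agree. *)
suff h c : gen c -> exists g, v g = c /\ f' g = f g.
  by move=> x; have [g [/v_inj <-]] := h (v x) (v_gen x).
move=> /(_ (fun c => exists g, v g = c /\ f' g = f g)); apply.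
- by exists 0; split; [apply: funext => s; rewrite v0|rewrite (additive0 f'D) (additive0 fD)].
- move=> _ _ [g [<- gf]] [h [<- hf]]; exists (g + h).
  by rewrite vD f'D fD gf hf.
- move=> _ [g [<- gf]]; exists (- g); rewrite (additiveN f'D) (additiveN fD) gf.
  split=> //; apply: funext => s; apply: (mulfI (mu_neq0 (gen_mu s (v_gen g)))).
  by rewrite -vDs subrr v0 mulfV // (mu_neq0 (gen_mu s (v_gen g))).
- move=> c1 x cx x0; have [g gc] := v_weight c1 x cx x0; exists g; split=> //.
  have gx : Rg0 g x by move=> s sX; rewrite gc; case: cx => /(_ s sX)[].
  have gx' : Rg (f' g) x.
    apply/f'push; exists [:: g], (fun=> x); rewrite big_seq1; split=> // h.
    by rewrite inE => /eqP->.
  apply/eqP; apply: contrapT => /negP ne; apply: x0.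
  by rewrite -(pr_id _ _ gx') (pr_0 _ (f g)) //; apply: f_sub.
Qed.

End FromCompact.

Theorem mainTheorem6 (e : steinitz) (k : comPzRingType) (R : pzRingType)
  (phi : k -> R) (Halg : is_kalg phi)
  (Hinj : forall d : nat, steinitz_dvd d e -> injective (fun r : R => r *+ d))
  (T : pzRingType) (i1 : R -> T) (j : algC -> T) (HT : is_tensor e i1 j) :
  has_universal_grading e phi <->
  (is_subgroup_A e phi i1 j (Xe e phi i1 j) /\
   abelian_set (Xe e phi i1 j) /\
   compactA e phi i1 j (Xe e phi i1 j)).
Proof.
split=> [[G0 [Rg0 univ]]|[Xsub [Xab Xcomp]]].
  split; first exact: (Xe_universal_subgroup Halg Hinj HT univ).
  split; first exact: (Xe_universal_abelian Halg Hinj HT univ).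
  exact: (Xe_universal_compact Halg Hinj HT univ).
exact: (has_universal_grading_of_compact Halg Hinj HT Xsub Xab Xcomp).
Qed.
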